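(* Let $X$ be a random vector taking values in a real separable F-space $B$, with law $\mu$, let $\{X_j: j\ge1\}$ be i.i.d. copies of $X$, and let $t_k:B\to\mathbb{R}$, $k\ge1$, be Borel measurable functionals such that $\{t_k(X):k\ge1\}$ are independent mean zero random variables with variances $\sigma_k^2\in(0,\infty)$. Assume that for every real sequence $\{c_k:k\ge1\}$ with $\lim_{k\to\infty}c_k/\sigma_k=0$ we have $\liminf_{k\to\infty}P(t_k(X)<c_k)>0$. Let $\mathcal{T}$ be the set of all finite linear combinations of $\{t_k:k\ge1\}$, and let $a\in B$. Assume that either conditions (A-I) (for this $a$) and (A-II) both hold, or condition (A-III) holds, where: (A-I) for all integers $d\ge 1$, $HD_{\mathbb{R}^d}(\Pi_d(a),\mu^{\Pi_d})>0$, where $\Pi_d(x)=(t_1(x),\ldots,t_d(x))$ for $x\in B$ and $\mu^{\Pi_d}$ is the image of $\mu$ on $\mathbb{R}^d$ under $\Pi_d$; (A-II) for some constant $c<\infty$, $\mathbb{E}(t_k^4(X))\le c[\mathbb{E}(t_k^2(X))]^2$ for all $k\ge1$; (A-III) there are constants $0<\lambda_k<\infty$ such that $\{t_k(X)/\lambda_k: k\ge1\}$ are i.i.d. with a probability density $\phi$ that is positive almost everywhere (Lebesgue), absolutely continuous on every compact interval of $\mathbb{R}$, and satisfies $\int_{\mathbb{R}}\frac{(\phi'(x))^2}{\phi(x)}\,dx<\infty$ and $\int_{\mathbb{R}}x^2\phi(x)\,dx<\infty$. Then: (1) If $\sum_{k\ge1}t_k^2(a)/\sigma_k^2<\infty$,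 then with probability one $HD_{\mathcal{T}}(a,\mu_n)=0$ for all $n\ge1$, while $HD_{\mathcal{T}}(a,\mu)>0$; hence consistency fails at $a$, i.e. $HD_{\mathcal{T}}(a,\mu_n)$ does not converge to $HD_{\mathcal{T}}(a,\mu)$ as $n\to\infty$. (2) If $\sum_{k\ge1}t_k^2(a)/\sigma_k^2=\infty$ but $\lim_{k\to\infty}t_k(a)/\sigma_k=0$, then consistency holds at $a$, i.e. with probability one $HD_{\mathcal{T}}(a,\mu_n)\to HD_{\mathcal{T}}(a,\mu)$ as $n\to\infty$.
   Context: A real separable F-space is a real topological vector space whose topology is induced by a complete, separable, translation invariant metric; it carries its Borel sigma-field. All random vectors are defined on a probability space $(\Omega,\mathcal{F},P)$ and are Borel measurable. For a collection $\mathcal{T}$ of Borel measurable functionals on $B$, a Borel probability $\nu$ on $B$ and $a\in B$, the half space depth is $$HD_{\mathcal{T}}(a,\nu)=\inf_{t\in\mathcal{T}}\nu(x\in B: t(x)\ge t(a)).$$ $\mu_n=\frac1n\sum_{j=1}^n\delta_{X_j}$ is the empirical measure, so $HD_{\mathcal{T}}(a,\mu_n)=\inf_{t\in\mathcal{T}}\frac1n\sum_{j=1}^nI(t(X_j)\ge t(a))$. For a Borel probability $\nu$ on $\mathbb{R}^d$ and $b\in\mathbb{R}^d$, $HD_{\mathbb{R}^d}(b,\nu)=\inf_{t}\nu(x\in\mathbb{R}^d: t(x)\ge t(b))$, the infimum being over all linear functionals $t$ on $\mathbb{R}^d$. The functionals $t_k$ are not assumed linear or continuous. *)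

(* Defs.v *)
From HB Require Import structures.
From mathcomp Require Import all_boot all_order all_algebra finmap.
From mathcomp Require Import all_classical all_reals all_analysis.
Import Order.TTheory GRing.Theory Num.Theory.
Import numFieldNormedType.Exports.

Set Implicit Arguments.
Unset Strict Implicit.
Unset Printing Implicit Defensive.

Local Open Scope classical_set_scope.
Local Open Scope ring_scope.

Section fspace.
Context {R : realType}.

Definition is_metric (B : Type) (rho : B -> B -> R) : Prop :=
  [/\ forall x y, 0 <= rho x y,
      forall x y, rho x y = 0 <-> x = y,
      forall x y, rho x y = rho y x &
      forall x y z, rho x z <= rho x y + rho y z].

Definition metrizes (B : topologicalType) (rho : B -> B -> R) : Prop :=
  forall (x : B) (A : set B),
    nbhs x A <-> exists2 e : R, 0 < e & [set y | rho x y < e] `<=` A.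

Definition metric_complete (B : Type) (rho : B -> B -> R) : Prop :=
  forall u : nat -> B,
    (forall e : R, 0 < e -> exists N : nat, forall m n : nat,
      (N <= m)%N -> (N <= n)%N -> rho (u m) (u n) < e) ->
    exists l : B, rho (u n) l @[n --> \oo] --> (0 : R).

Definition separable (B : topologicalType) : Prop :=
  exists2 D : set B, countable D & dense D.

Definition separable_Fspace (B : topologicalLmodType R) : Prop :=
  separable B /\
  exists rho : B -> B -> R,
    [/\ is_metric rho, metrizes rho, metric_complete rho &
        forall x y z : B, rho (x + z) (y + z) = rho x y].

(* [B] with its Borel sigma-algebra; [g_sigma_algebraType] is not used because
   it requires a pointed carrier, which [topologicalLmodType] does not provide;
   the point chosen here is the zero vector. *)
Definition borelType (B : topologicalLmodType R) : Type := B.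

End fspace.

Section borel_instances.
Context {R : realType} (B : topologicalLmodType R).

HB.instance Definition _ := Choice.on (borelType B).
HB.instance Definition _ := isPointed.Build (borelType B) (0 : B).

Let borel : set (set (borelType B)) := <<s @open B >>.

Let borelC (A : set (borelType B)) : borel A -> borel (~` A).
Proof. by move=> bA; rewrite -setTD; exact: sigma_algebraCD. Qed.

HB.instance Definition _ := @isMeasurable.Build (sigma_display (@open B))
  (borelType B) borel (@sigma_algebra0 _ setT (@open B)) borelC
  (@sigma_algebra_bigcup _ setT (@open B)).

End borel_instances.

Section probability.
Context {R : realType}.

Definition mutually_independent d d' (Omega : measurableType d)
    (E : measurableType d') (P : probability Omega R)
    (Y : nat -> Omega -> E) : Prop :=
  forall (J : {fset nat}) (A : nat -> set E),
    (forall j, j \in J -> measurable (A j)) ->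
    P (\bigcap_(j in [set` J]) (Y j @^-1` A j)) =
    (\prod_(j <- J) P (Y j @^-1` A j))%E.

(* Laws are compared on measurable sets only: the value of a measure on other
   sets is unspecified. *)
Definition same_law d d' (Omega : measurableType d) (E : measurableType d')
    (P : probability Omega R) (X Y : {RV P >-> E}) : Prop :=
  forall A : set E, measurable A -> distribution P X A = distribution P Y A.

Definition iid_copies d d' (Omega : measurableType d) (E : measurableType d')
    (P : probability Omega R) (X : {RV P >-> E}) (Xs : nat -> {RV P >-> E}) :
    Prop :=
  mutually_independent P (fun j => Xs j : Omega -> E) /\
  forall j, same_law (Xs j) X.

Definition empirical d (E : measurableType d) (x : nat -> E) (n : nat) :
    set E -> \bar R :=
  mscale (n%:R^-1)%:nng (msum (fun j => \d_(x j)) n).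

Definition absolutely_continuous_on (a b : R) (f : R -> R) : Prop :=
  forall e : R, 0 < e -> exists2 delta : R, 0 < delta &
    forall (n : nat) (u v : 'I_n -> R),
      (forall i, [/\ a <= u i, u i <= v i & v i <= b]) ->
      trivIset setT (fun i => `]u i, v i[%classic) ->
      \sum_(i < n) (v i - u i) < delta ->
      \sum_(i < n) `|f (v i) - f (u i)| < e.

Definition probability_density (phi : R -> R) : Prop :=
  [/\ measurable_fun setT phi, forall x, 0 <= phi x &
      (\int[lebesgue_measure]_x (phi x)%:E = 1)%E].

Definition has_density d (Omega : measurableType d) (P : probability Omega R)
    (Y : Omega -> R) (phi : R -> R) : Prop :=
  forall A : set R, measurable A ->
    (P (Y @^-1` A) = \int[lebesgue_measure]_(x in A) (phi x)%:E)%E.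

(* For an absolutely continuous [phi] the derivative exists Lebesgue-almost
   everywhere, so the default value of [derive1 phi] elsewhere, like the value of
   the quotient on the null set where [phi] vanishes, is immaterial. *)
Definition iid_scaled_regular_density d (Omega : measurableType d)
    (P : probability Omega R) (Y : nat -> Omega -> R) : Prop :=
  exists (lambda : nat -> R) (phi : R -> R),
    (forall k, 0 < lambda k) /\
    mutually_independent P (fun k w => Y k w / lambda k) /\
    probability_density phi /\
    (forall k, has_density P (fun w => Y k w / lambda k) phi) /\
    {ae lebesgue_measure, forall x : R, 0 < phi x} /\
    (forall a b : R, a <= b -> absolutely_continuous_on a b phi) /\
    (\int[lebesgue_measure]_x (derive1 phi x ^+ 2 / phi x)%:E < +oo)%E /\
    (\int[lebesgue_measure]_x (x ^+ 2 * phi x)%:E < +oo)%E.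

End probability.

Section half_space_depth.
Context {R : realType}.

Definition HD (E : Type) (T : set (E -> R)) (a : E) (nu : set E -> \bar R) :
    \bar R :=
  ereal_inf [set nu [set x | t a <= t x] | t in T].

Definition linear_functionals (d : nat) : set (borelType 'rV[R]_d -> R) :=
  [set t | scalar (t : 'rV[R]_d -> R)].

Definition finite_combinations (E : Type) (t : nat -> E -> R) : set (E -> R) :=
  [set f | exists (n : nat) (c : nat -> R),
     f = (fun x => \sum_(k < n) c k * t k x)].

(* Sequences are indexed from 0: [Pi t d x] is the row of the first [d] values
   [t 0 x, ..., t d.-1 x]. *)
Definition Pi (E : Type) (t : nat -> E -> R) (d : nat) (x : E) :
    borelType 'rV[R]_d :=
  \row_(i < d) t i x.

End half_space_depth.

(* Main.v *)
(* Write Y_k = t_k(X) and alpha_k = t_k(a).  When alpha_k / sigma_k -> 0, for every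
   n the events {t_k(X_j) < t_k(a) for all j < n} are independent in k with
   probabilities bounded away from 0, so one of them occurs and the single
   functional t_k witnesses that the empirical depth is 0.
   If the series diverges, Chebyshev's inequality for the functional with
   coefficients alpha_k / sigma_k^2 bounds the depth at a under mu by the inverse of
   the partial sums, hence it vanishes.
   If the series converges, split a functional into a head (k < N), whose half
   spaces have mass bounded below by finite-dimensional positivity, and an
   independent tail.  By Cauchy-Schwarz the normalised tail only has to exceed the
   small number (sum_(k >= N) alpha_k^2 / sigma_k^2)^(1/2), and uniform square
   integrability of the Y_k / sigma_k makes this happen with probability bounded
   below. *)
Require Import Defs.
From HB Require Import structures.
From mathcomp Require Import all_boot all_order all_algebra finmap.
From mathcomp Require Import all_classical all_reals all_analysis.
From mathcomp Require Import measurable_realfun ring lra.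
Import Order.TTheory GRing.Theory Num.Theory.
Import numFieldNormedType.Exports.

Set Implicit Arguments.
Unset Strict Implicit.
Unset Printing Implicit Defensive.

Local Open Scope classical_set_scope.
Local Open Scope ring_scope.

(** * Independence *)

Section independence.
Context {R : realType} d (Omega : measurableType d) (P : probability Omega R).

(** Independence is defined over finite sets of indices; the products below run over intervals
    [iota], so it is transferred to duplicate-free lists. *)
Lemma mutually_independent_seq d' (E : measurableType d')
    (Y : nat -> Omega -> E) (s : seq nat) (A : nat -> set E) :
  mutually_independent P Y -> uniq s ->
  (forall j, j \in s -> measurable (A j)) ->
  P (\bigcap_(j in [set` s]) (Y j @^-1` A j)) =
  (\prod_(j <- s) P (Y j @^-1` A j))%E.
Proof.
move=> indY us mA.
have := indY [fset x in s]%fset A; rewrite (perm_big s) /=; last first.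
  apply: uniq_perm; [exact: fset_uniq|by []|move=> x; by rewrite !inE].
move=> <-; last by move=> j; rewrite !inE; exact: mA.
by congr (P _); apply: eq_bigcapl; split=> x /=; rewrite !inE.
Qed.

Lemma mutually_independent_comp d1 d2 (E1 : measurableType d1)
    (E2 : measurableType d2) (Y : nat -> Omega -> E1) (f : nat -> E1 -> E2) :
  (forall k, measurable_fun setT (f k)) ->
  mutually_independent P Y -> mutually_independent P (fun k => f k \o Y k).
Proof.
move=> mf indY J A mA; apply: (indY J (fun k => f k @^-1` A k)) => j jJ.
by rewrite -[X in measurable X]setTI; apply: mf => //; exact: mA.
Qed.

Definition independent_pair d1 d2 (E1 : measurableType d1)
    (E2 : measurableType d2) (U : Omega -> E1) (V : Omega -> E2) :=
  forall A B, measurable A -> measurable B ->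
    P (U @^-1` A `&` V @^-1` B) = (P (U @^-1` A) * P (V @^-1` B))%E.

Lemma independent_pair_comp d1 d2 d3 d4 (E1 : measurableType d1)
    (E2 : measurableType d2) (E3 : measurableType d3) (E4 : measurableType d4)
    (U : Omega -> E1) (V : Omega -> E2) (f : E1 -> E3) (g : E2 -> E4) :
  measurable_fun setT f -> measurable_fun setT g ->
  independent_pair U V -> independent_pair (f \o U) (g \o V).
Proof.
move=> mf mg indUV A B mA mB; apply: (indUV (f @^-1` A) (g @^-1` B)).
  by rewrite -[X in measurable X]setTI; exact: mf.
by rewrite -[X in measurable X]setTI; exact: mg.
Qed.

(** Independence makes the joint law of the pair the product of the two laws; Tonelli then gives
    integrability of the product and Fubini its mean. *)
Lemma independent_pairM (U V : Omega -> R) :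
  P.-integrable setT (EFin \o U) -> P.-integrable setT (EFin \o V) ->
  independent_pair U V ->
  P.-integrable setT (EFin \o (U \* V)) /\
  \int[P]_w (U w * V w) = (\int[P]_w U w) * (\int[P]_w V w).
Proof.
move=> iU iV indUV.
have mU : measurable_fun setT U by apply/measurable_EFinP; exact: measurable_int iU.
have mV : measurable_fun setT V by apply/measurable_EFinP; exact: measurable_int iV.
have mUV : measurable_fun setT (fun w => (U w, V w)) by exact: measurable_fun_pair.
pose U' : {mfun Omega >-> R} := mfun_Sub (mem_set mU).
pose V' : {mfun Omega >-> R} := mfun_Sub (mem_set mV).
pose W : {mfun Omega >-> (R * R)%type} := mfun_Sub (mem_set mUV).
pose f (z : R * R) := (z.1 * z.2)%:E.
have mf : measurable_fun setT f.
  by apply/measurable_EFinP; apply: measurable_funM; [exact: measurable_fst|exact: measurable_snd].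
(* A product measure is determined by its values on rectangles, which is where independence
   enters. *)
have eqW A : measurable A ->
    (distribution P U' \x distribution P V')%E A = distribution P W A.
  by apply: product_measure_unique => {}A B mA mB; exact: indUV.
have absU : (\int[distribution P U']_x `|x%:E| = \int[P]_w `|(U w)%:E|)%E.
  rewrite ge0_integral_distribution//.
  by apply/measurableT_comp => //; apply/measurable_EFinP; exact: measurable_id.
have absV : (\int[distribution P V']_x `|x%:E| = \int[P]_w `|(V w)%:E|)%E.
  rewrite ge0_integral_distribution//.
  by apply/measurableT_comp => //; apply/measurable_EFinP; exact: measurable_id.
have ltU : (\int[P]_w `|(U w)%:E| < +oo)%E by case/integrableP: iU.
have ltV : (\int[P]_w `|(V w)%:E| < +oo)%E by case/integrableP: iV.
have mid : measurable_fun setT (fun x : R => `|x%:E|)%E.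
  by apply/measurableT_comp => //; apply/measurable_EFinP; exact: measurable_id.
(* The iterated integral of the absolute value is the product of the two absolute first moments,
   hence finite. *)
have if_prod : (distribution P U' \x distribution P V')%E.-integrable setT f.
  apply/integrable12ltyP => //.
  have E x : (\int[distribution P V']_y `|f (x, y)| = `|x%:E| * \int[P]_w `|(V w)%:E|)%E.
    rewrite -absV -ge0_integralZl//; apply: eq_integral => y _.
    by rewrite /f EFinM abseM.
  under eq_integral => x _ do rewrite E.
  rewrite ge0_integralZr//; last by apply: integral_ge0.
  by rewrite absU lte_mul_pinfty ?integral_ge0// fin_numElt ltU (lt_le_trans ltNy0)// integral_ge0.
have if_W : (distribution P W).-integrable setT f.
  apply/integrableP; split => //.
  case/integrableP: if_prod => _; congr (_ < _)%E; apply: eq_measure_integral => A mA _.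
  exact: eqW.
have iUV : P.-integrable setT (EFin \o (U \* V)).
  apply/integrableP; split; first by apply/measurable_EFinP; exact: measurable_funM.
  case/integrableP: if_W => _; rewrite ge0_integral_distribution//.
  exact/measurableT_comp.
split=> //.
rewrite /Rintegral.
have -> : (\int[P]_w (U w * V w)%:E = \int[distribution P W]_z f z)%E.
  by rewrite integral_distribution.
rewrite -(@eq_measure_integral _ _ _ _ _ (distribution P U' \x distribution P V')%E); last first.
  by move=> A mA _; exact: eqW.
rewrite -integral12_prod_meas1//=.
have iV' : (distribution P V').-integrable setT (EFin \o (@idfun R)).
  by apply/integrableP; split; [by apply/measurable_EFinP; exact: measurable_id|rewrite absV].
have iU' : (distribution P U').-integrable setT (EFin \o (@idfun R)).
  by apply/integrableP; split; [by apply/measurable_EFinP; exact: measurable_id|rewrite absU].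
have EV : (\int[distribution P V']_x x%:E = \int[P]_w (V w)%:E)%E.
  apply: (@integral_distribution _ _ _ _ _ _ V' (EFin \o (@idfun R))).
    exact: measurable_int iV'.
  exact: iV.
have EU : (\int[distribution P U']_x x%:E = \int[P]_w (U w)%:E)%E.
  apply: (@integral_distribution _ _ _ _ _ _ U' (EFin \o (@idfun R))).
    exact: measurable_int iU'.
  exact: iU.
have fU : (\int[P]_w (U w)%:E)%E \is a fin_num by exact: integrable_fin_num.
have fV : (\int[P]_w (V w)%:E)%E \is a fin_num by exact: integrable_fin_num.
have E x : (fubini_F (distribution P V') f x = x%:E * \int[P]_w (V w)%:E)%E.
  rewrite /fubini_F -EV -(integralZl _ iV')//; exact: eq_integral.
under eq_integral => x _ do rewrite E.
by rewrite -(fineK fV) integralZr// EU -(fineK fU) -EFinM.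
Qed.

(** * Independence of disjoint groups of coordinates *)

Section grouping.
Variable Y : nat -> Omega -> R.
Hypothesis mY : forall k, measurable_fun setT (Y k).
Hypothesis indY : mutually_independent P Y.

(** A pi-system generating the sigma-algebra of the coordinates [k < N] with [D k]. The coordinates
    outside [D] are kept with the trivial constraint [setT], so that rectangles for [D] and for its
    complement intersect coordinatewise. *)
Definition rectangles (N : nat) (D : pred nat) : set (set Omega) :=
  [set C | exists A : nat -> set R,
    [/\ forall k, measurable (A k), forall k, ~~ D k -> A k = setT &
        C = \bigcap_(k in [set` iota 0 N]) (Y k @^-1` A k)]].

Let mpre k (A : set R) : measurable A -> measurable (Y k @^-1` A).
Proof. by move=> mA; rewrite -[X in measurable X]setTI; exact: mY. Qed.

Lemma rectangles_measurable N D : rectangles N D `<=` measurable.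
Proof.
move=> _ [A [mA _ ->]].
rewrite (_ : \bigcap_(_ in _) _ = \big[setI/setT]_(k <- iota 0 N) (Y k @^-1` A k)).
  by apply: bigsetI_measurable => k _; exact: mpre.
by rewrite bigcap_seq.
Qed.

Lemma rectanglesI N D : setI_closed (rectangles N D).
Proof.
move=> _ _ [A [mA AD ->]] [B [mB BD ->]]; exists (fun k => A k `&` B k); split.
- by move=> k; exact: measurableI.
- by move=> k Dk; rewrite AD// BD// setIT.
- by rewrite -bigcapI.
Qed.

Lemma rectanglesT N D : rectangles N D setT.
Proof.
by exists (fun=> setT); split => //; apply/esym/seteqP; split=> // w _ k.
Qed.

Lemma independent_rectangles N D A B :
  rectangles N D A -> rectangles N (predC D) B -> P (A `&` B) = (P A * P B)%E.
Proof.
move=> [A' [mA AD ->]] [B' [mB BD ->]].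
rewrite -bigcapI.
have -> : \bigcap_(k in [set` iota 0 N]) (Y k @^-1` A' k `&` Y k @^-1` B' k)
  = \bigcap_(k in [set` iota 0 N]) (Y k @^-1` (A' k `&` B' k)) by [].
rewrite !mutually_independent_seq ?iota_uniq//; last first.
  by move=> j _; exact: measurableI.
rewrite -big_split/=; apply: eq_bigr => k _.
have [Dk|Dk] := boolP (D k).
  by rewrite BD /= ?Dk// setIT preimage_setT probability_setT mule1.
by rewrite AD// setTI preimage_setT probability_setT mul1e.
Qed.

Lemma sub_rectangles_measurable N D : <<s rectangles N D >> `<=` measurable.
Proof.
by apply: smallest_sub; [exact: sigma_algebra_measurable|exact: rectangles_measurable].
Qed.

(** Two finite measures that agree on a pi-system containing the whole space agree on the
    sigma-algebra it generates. *)
Lemma independent_generated (G H : set (set Omega)) :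
  G `<=` measurable -> setI_closed G -> G setT -> H `<=` measurable ->
  (forall A B, G A -> H B -> P (A `&` B) = (P A * P B)%E) ->
  forall A B, <<s G >> A -> H B -> P (A `&` B) = (P A * P B)%E.
Proof.
move=> mG GI GT mH ind A B sA HB; have mB := mH _ HB.
rewrite muleC.
have PBE : P B = (fine (P B))%:E by rewrite fineK// fin_num_measure.
rewrite PBE.
have PB0 : 0 <= fine (P B) by rewrite fine_ge0.
pose r := NngNum PB0.
(* With [B] fixed, both sides are measures of [A]: the restriction of [P] to [B], and [P] scaled by
   the mass of [B]. *)
change (mrestr P mB A = mscale r P A).
apply: (@g_sigma_algebra_measure_unique _ _ _ G mG (fun=> setT)) => //.
- by rewrite bigcup_const.
- move=> C GC; transitivity (P C * P B)%E; first exact: ind.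
  change (P C * P B = (fine (P B))%:E * P C)%E.
  by rewrite -PBE muleC.
- move=> _; change (P (setT `&` B) < +oo)%E.
  by rewrite setTI ltey_eq fin_num_measure.
Qed.

(** The pi-system extension is applied twice, to one side of the intersection at a time. *)
Lemma independent_sigma_rectangles N D A B :
  <<s rectangles N D >> A -> <<s rectangles N (predC D) >> B ->
  P (A `&` B) = (P A * P B)%E.
Proof.
move=> sA sB; rewrite setIC muleC.
apply: (@independent_generated _ <<s rectangles N D >> _ _ _ _ _ B A sB sA) => //.
- exact: rectangles_measurable.
- exact: rectanglesI.
- exact: rectanglesT.
- exact: sub_rectangles_measurable.
move=> {A B sA sB} B A rB sA; rewrite setIC muleC.
apply: (@independent_generated _ (rectangles N (predC D)) _ _ _ _ _ A B sA rB).
- exact: rectangles_measurable.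
- exact: rectanglesI.
- exact: rectanglesT.
- exact: rectangles_measurable.
exact: independent_rectangles.
Qed.

Lemma measurable_coordinate N (D : pred nat) k : (k < N)%N -> D k ->
  @measurable_fun _ _ (g_sigma_algebraType (rectangles N D)) R setT (Y k).
Proof.
move=> kN Dk _ A mA; rewrite setTI; apply: sub_gen_smallest.
exists (fun j => if j == k then A else setT); split.
- by move=> j; case: ifP.
- by move=> j; case: ifPn => // /eqP ->; rewrite Dk.
- apply/seteqP; split=> [w YA j _|w /(_ k)] /=.
    by case: ifPn => // /eqP ->.
  by rewrite eqxx; apply; rewrite mem_iota.
Qed.

(** Each sum is measurable for the sigma-algebra of its own group of coordinates. Arbitrary
    measurable transforms are allowed so that truncated variables are covered too. *)
Lemma independent_sums N (D : pred nat) (f g : nat -> R -> R) :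
  (forall k, measurable_fun setT (f k)) ->
  (forall k, measurable_fun setT (g k)) ->
  independent_pair (fun w => \sum_(k < N | D k) f k (Y k w))
                   (fun w => \sum_(k < N | ~~ D k) g k (Y k w)).
Proof.
have msum (E : pred nat) (h : nat -> R -> R) :
    (forall k, measurable_fun setT (h k)) ->
    @measurable_fun _ _ (g_sigma_algebraType (rectangles N E)) R setT
      (fun w => \sum_(k < N | E k) h k (Y k w)).
  move=> mh; under eq_fun do rewrite big_mkcond/=.
  apply: measurable_sum => k.
  have [Ek|] := boolP (E k); last by move=> _; exact: measurable_cst.
  by apply: measurableT_comp => //; exact: measurable_coordinate.
move=> mf mg A B mA mB; apply: (@independent_sigma_rectangles N D).
  by have := msum D _ mf measurableT A mA; rewrite setTI.
by have := msum (predC D) _ mg measurableT B mB; rewrite setTI.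
Qed.

(** The grouping of [N.+1] coordinates in which the second group is the last one alone; it drives
    the inductions on the number of summands. *)
Lemma independent_next N (f g : nat -> R -> R) :
  (forall k, measurable_fun setT (f k)) ->
  (forall k, measurable_fun setT (g k)) ->
  independent_pair (fun w => \sum_(k < N) f k (Y k w)) (g N \o Y N).
Proof.
move=> mf mg; have := @independent_sums N.+1 (fun k => k < N)%N f g mf mg.
congr independent_pair; apply/funext => w.
  rewrite big_mkcond big_ord_recr /= ltnn addr0.
  by apply: eq_bigr => k _; rewrite ltn_ord.
rewrite big_mkcond big_ord_recr /= ltnn /= big1 ?add0r// => k _.
by rewrite ltn_ord.
Qed.

End grouping.
End independence.

(** * Moments of sums of independent variables *)

Section mean.
Context {R : realType} d (Omega : measurableType d) (P : probability Omega R).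

Implicit Types (f g : Omega -> R) (m c M : R) (A : set Omega).

(** [Rintegral] takes a value even on non-integrable functions, so integrability is carried along
    with the value. *)
Definition has_mean (f : Omega -> R) (m : R) :=
  P.-integrable setT (EFin \o f) /\ \int[P]_w f w = m.

Lemma has_meanE f m : has_mean f m -> \int[P]_w f w = m.
Proof. by case. Qed.

Lemma has_mean_measurable f m : has_mean f m -> measurable_fun setT f.
Proof. by case=> fi _; apply/measurable_EFinP; exact: measurable_int fi. Qed.

Lemma eq_has_mean f g m m' :
  has_mean f m -> f =1 g -> m = m' -> has_mean g m'.
Proof. by move=> fm /funext <- <-. Qed.

Lemma has_mean_cst c : has_mean (fun=> c) c.
Proof.
split; first exact: finite_measure_integrable_cst.
have -> := Rintegral_cst P measurableT c.
rewrite (_ : fine _ = 1) ?mulr1//.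
exact: (congr1 fine (probability_setT P)).
Qed.

Lemma has_meanD f g m m' : has_mean f m -> has_mean g m' ->
  has_mean (fun w => f w + g w) (m + m').
Proof.
move=> [fi fm] [gi gm]; split; last by rewrite RintegralD// fm gm.
by have := integrableD measurableT fi gi; apply: eq_integrable.
Qed.

Lemma has_meanZ c f m : has_mean f m -> has_mean (fun w => c * f w) (c * m).
Proof.
move=> [fi fm]; split; last by rewrite RintegralZl// fm.
by have := integrableZl measurableT c fi; apply: eq_integrable.
Qed.

Lemma has_meanM f g m m' : independent_pair P f g -> has_mean f m ->
  has_mean g m' -> has_mean (fun w => f w * g w) (m * m').
Proof.
by move=> fg [fi <-] [gi <-]; exact: independent_pairM.
Qed.

Lemma has_mean_dominated f g m : measurable_fun setT f ->
  (forall w, `|f w| <= g w) -> has_mean g m -> has_mean f (\int[P]_w f w).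
Proof.
move=> mf fg [gi _]; split => //; apply: le_integrable gi => //.
  exact/measurable_EFinP.
by move=> w _ /=; rewrite lee_fin (le_trans (fg w))// ler_norm.
Qed.

Lemma has_mean_bounded f M : measurable_fun setT f ->
  (forall w, `|f w| <= M) -> has_mean f (\int[P]_w f w).
Proof. by move=> mf fM; exact: has_mean_dominated fM (has_mean_cst M). Qed.

Lemma has_mean_le f g m m' : has_mean f m -> has_mean g m' ->
  (forall w, f w <= g w) -> m <= m'.
Proof. by move=> [fi <-] [gi <-] fg; exact: le_Rintegral. Qed.

Lemma has_mean_indic A : measurable A -> has_mean \1_A (fine (P A)).
Proof.
move=> mA; split; first by apply: integrable_indic; rewrite // ltey_eq fin_num_measure.
by rewrite /Rintegral integral_indic// setIT.
Qed.

Lemma has_mean_sum (f : nat -> Omega -> R) (b : nat -> R) n :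
  (forall k, has_mean (f k) 0) ->
  has_mean (fun w => \sum_(k < n) b k * f k w) 0.
Proof.
move=> f0; elim: n => [|n IH].
  by apply: eq_has_mean (has_mean_cst 0) _ _ => // w; rewrite big_ord0.
apply: eq_has_mean (has_meanD IH (has_meanZ (b n) (f0 n))) _ _.
  by move=> w; rewrite big_ord_recr.
by rewrite mulr0 addr0.
Qed.

(** * Second and fourth moments of weighted sums *)

Section sums.
Variable xi : nat -> Omega -> R.
Hypothesis mxi : forall k, measurable_fun setT (xi k).
Hypothesis indxi : mutually_independent P xi.
Variable s2 : nat -> R.
Hypothesis xi1 : forall k, has_mean (xi k) 0.
Hypothesis xi2 : forall k, has_mean (fun w => xi k w ^+ 2) (s2 k).
Variable b : nat -> R.

Let U n w := \sum_(k < n) b k * xi k w.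

Let indU n (h : R -> R) : measurable_fun setT h ->
  independent_pair P (U n) (h \o xi n).
Proof.
move=> mh.
apply: (@independent_next _ _ _ _ _ mxi indxi n (fun k x => b k * x) (fun=> h)) => // k.
by apply: measurable_funM => //; exact: measurable_id.
Qed.

(** Variances add: in the induction the cross term is a product of independent centred factors, so
    its mean is 0. *)
Lemma has_mean_sum_sqr n :
  has_mean (fun w => U n w ^+ 2) (\sum_(k < n) b k ^+ 2 * s2 k).
Proof.
elim: n => [|n IH].
  apply: eq_has_mean (has_mean_cst 0) _ _ => [w|].
    by rewrite /U big_ord0 expr0n.
  by rewrite big_ord0.
have cross := has_meanM (indU n (@measurable_id _ _ setT)) (has_mean_sum b n xi1) (xi1 n).
have := has_meanD (has_meanD IH (has_meanZ (2 * b n) cross)) (has_meanZ (b n ^+ 2) (xi2 n)).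
move/eq_has_mean; apply => [w|].
  by rewrite /U big_ord_recr/= !(mulr2n, expr2); ring.
by rewrite big_ord_recr/= mul0r mulr0 addr0.
Qed.

(** Bounded functions, centred along the variables; they are later instantiated by centred
    truncations. *)
Variable g : nat -> R -> R.
Hypothesis mg : forall k, measurable_fun setT (g k).
Variable K : R.
Hypothesis gK : forall k x, `|g k x| <= K.
Hypothesis g1 : forall k, has_mean (g k \o xi k) 0.
Variable beta : nat -> R.
Hypothesis xig : forall k, has_mean (fun w => xi k w * g k (xi k w)) (beta k).

Let G n w := \sum_(k < n) b k * g k (xi k w).

Let indG n (h : R -> R) : measurable_fun setT h ->
  independent_pair P (G n) (h \o xi n).
Proof.
move=> mh.
apply: (@independent_next _ _ _ _ _ mxi indxi n (fun k x => b k * g k x) (fun=> h)) => // k.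
exact: measurable_funM.
Qed.

(** Only diagonal terms survive: each off-diagonal product factors into two means that are 0. *)
Lemma has_mean_sum_mul n :
  has_mean (fun w => U n w * G n w) (\sum_(k < n) b k ^+ 2 * beta k).
Proof.
elim: n => [|n IH].
  apply: eq_has_mean (has_mean_cst 0) _ _ => [w|].
    by rewrite /U big_ord0 mul0r.
  by rewrite big_ord0.
have cross1 := has_meanM (indU n (mg n)) (has_mean_sum b n xi1) (g1 n).
have cross2 := has_meanM (indG n (@measurable_id _ _ setT)) (has_mean_sum b n g1) (xi1 n).
have := has_meanD (has_meanD IH (has_meanZ (b n) (has_meanD cross1 cross2)))
  (has_meanZ (b n ^+ 2) (xig n)).
move/eq_has_mean; apply => [w|].
  by rewrite /U /G !big_ord_recr/=; ring.
by rewrite big_ord_recr/= !mul0r addr0 mulr0 addr0.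
Qed.

Let measG n : measurable_fun setT (G n).
Proof. exact: has_mean_measurable (has_mean_sum b n g1). Qed.

Let meang k p : has_mean (fun w => g k (xi k w) ^+ p) (\int[P]_w (g k (xi k w) ^+ p)).
Proof.
apply: (@has_mean_bounded _ (K ^+ p)).
  by apply: measurable_funX; exact: measurableT_comp.
by move=> w; rewrite normrX lerXn2r ?nnegrE// (le_trans _ (gK k (xi k w))).
Qed.

Let meanG n p : has_mean (fun w => G n w ^+ p) (\int[P]_w (G n w ^+ p)).
Proof.
apply: (@has_mean_bounded _ ((\sum_(k < n) `|b k| * K) ^+ p)).
  exact: measurable_funX.
move=> w; have GK : `|G n w| <= \sum_(k < n) `|b k| * K.
  apply: le_trans (ler_norm_sum _ _ _) _; apply: ler_sum => k _.
  by rewrite normrM ler_wpM2l.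
by rewrite normrX lerXn2r ?nnegrE// (le_trans _ GK).
Qed.

Let K0 : 0 <= K. Proof. exact: le_trans (normr_ge0 _) (gK 0 0). Qed.

Let meang_le k p : \int[P]_w (g k (xi k w) ^+ p) <= K ^+ p.
Proof.
apply: has_mean_le (meang k p) (has_mean_cst _) _ => w.
by rewrite (le_trans (ler_norm _))// normrX lerXn2r ?nnegrE.
Qed.

Let meanX n p q : has_mean (fun w => G n w ^+ p * g n (xi n w) ^+ q)
  ((\int[P]_w (G n w ^+ p)) * (\int[P]_w (g n (xi n w) ^+ q))).
Proof.
apply: has_meanM (meanG n p) (meang n q).
change (independent_pair P ((fun x => x ^+ p) \o G n)
  ((fun x => x ^+ q) \o (g n \o xi n))).
apply: independent_pair_comp (indG n (mg n)).
- by apply: measurable_funX; exact: measurable_id.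
- by apply: measurable_funX; exact: measurable_id.
Qed.

Lemma mean_sum_bounded_sqr n :
  \int[P]_w (G n w ^+ 2) <= K ^+ 2 * \sum_(k < n) b k ^+ 2.
Proof.
elim: n => [|n IH].
  rewrite big_ord0 mulr0 /G.
  by under eq_Rintegral do rewrite big_ord0 expr0n; rewrite (has_meanE (has_mean_cst 0)).
have EG1 : \int[P]_w (G n w ^+ 1) = 0 by exact: has_meanE (has_mean_sum b n g1).
have H := has_meanD (has_meanD (meanG n 2) (has_meanZ (2 * b n) (meanX n 1 1)))
  (has_meanZ (b n ^+ 2) (meang n 2)).
have [] := @eq_has_mean _ (fun w => G n.+1 w ^+ 2) _ _ H _ erefl.
  by move=> w; rewrite /G big_ord_recr/=; ring.
move=> _ ->; rewrite EG1 mul0r mulr0 addr0 big_ord_recr/= mulrDr lerD//.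
by rewrite mulrC ler_wpM2r ?sqr_ge0.
Qed.

(** A Khintchine-type bound. In the expansion of the fourth power of the next sum, the terms with a
    first power of [G n] or of [g n] have mean 0, and the two remaining terms are controlled by the
    second moment bound and by [K]. *)
Lemma mean_sum_bounded_exp4 n :
  \int[P]_w (G n w ^+ 4) <= 3 * K ^+ 4 * (\sum_(k < n) b k ^+ 2) ^+ 2.
Proof.
elim: n => [|n IH].
  rewrite big_ord0 expr0n mulr0 /G.
  by under eq_Rintegral do rewrite big_ord0 expr0n; rewrite (has_meanE (has_mean_cst 0)).
have EG1 : \int[P]_w (G n w ^+ 1) = 0 by exact: has_meanE (has_mean_sum b n g1).
have Eg1 : \int[P]_w (g n (xi n w) ^+ 1) = 0 by exact: has_meanE (g1 n).
have H := has_meanD (has_meanD (has_meanD (has_meanD (meanG n 4)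
    (has_meanZ (4 * b n) (meanX n 3 1))) (has_meanZ (6 * b n ^+ 2) (meanX n 2 2)))
    (has_meanZ (4 * b n ^+ 3) (meanX n 1 3))) (has_meanZ (b n ^+ 4) (meang n 4)).
have [] := @eq_has_mean _ (fun w => G n.+1 w ^+ 4) _ _ H _ erefl.
  by move=> w; rewrite /G big_ord_recr/=; ring.
move=> _ ->; rewrite EG1 Eg1 mul0r !mulr0 !addr0 big_ord_recr/=.
set s := \sum_(k < n) b k ^+ 2 in IH *.
have s0 : 0 <= s by apply: sumr_ge0 => k _; exact: sqr_ge0.
have le2 : (\int[P]_w (G n w ^+ 2)) * (\int[P]_w (g n (xi n w) ^+ 2)) <= K ^+ 2 * s * K ^+ 2.
  apply: ler_pM (mean_sum_bounded_sqr n) (meang_le n 2).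
    by apply: Rintegral_ge0 => w _; exact: sqr_ge0.
  by apply: Rintegral_ge0 => w _; exact: sqr_ge0.
have b2 : 0 <= b n ^+ 2 by exact: sqr_ge0.
have b4 : 0 <= b n ^+ 4 by rewrite -[4%N]/(2 * 2)%N exprM sqr_ge0.
apply: le_trans (lerD (lerD IH (ler_wpM2l _ le2)) (ler_wpM2l b4 (meang_le n 4))) _.
  by rewrite mulr_ge0.
have K4 : 0 <= K ^+ 4 by rewrite exprn_ge0.
(* The right side exceeds the left by exactly twice this quantity. *)
have : 0 <= K ^+ 4 * b n ^+ 4 by rewrite mulr_ge0.
by nra.
Qed.

End sums.
End mean.

(** * Anticoncentration of sums *)

Section anticoncentration.
Context {R : realType} d (Omega : measurableType d) (P : probability Omega R).

(** Large values become 0 rather than [M], so that [x * trunc M x] is either [x ^+ 2] or 0. *)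
Definition trunc (M x : R) : R := if `|x| <= M then x else 0.

Lemma measurable_trunc M : measurable_fun setT (trunc M).
Proof.
apply: measurable_fun_ifT => //.
by apply: measurable_fun_ler => //; apply: measurableT_comp => //; exact: measurable_id.
Qed.

Lemma trunc_le M x : 0 <= M -> `|trunc M x| <= M.
Proof. by move=> M0; rewrite /trunc; case: ifP => // _; rewrite normr0. Qed.

Lemma trunc_mul_ge0 M x : 0 <= x * trunc M x.
Proof. by rewrite /trunc; case: ifP; rewrite ?mulr0// -expr2 sqr_ge0. Qed.

Lemma trunc_mul_le M x : x * trunc M x <= x ^+ 2.
Proof. by rewrite /trunc; case: ifP => _; rewrite ?mulr0 ?sqr_ge0// -expr2. Qed.

(** A pointwise inequality made to be integrated: when [u] has mean 0, it turns a lower bound on the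
    mean of [u * g] into one on the probability that [e <= u]. *)
Lemma duality_bound (L e u g : R) : 0 < L -> 0 < e ->
  u * g <= L * (2 * (e + e * u ^+ 2 + (e <= u)%R%:R / (4 * e)) - u)
           + 8^-1 * u ^+ 2 + 2 / L ^+ 2 * g ^+ 4.
Proof.
move=> L0 e0.
(* The absolute value is twice the positive part minus [u]. The positive part is at most [e] when
   [u < e], and otherwise at most [e * u ^+ 2 + (4 * e)^-1] by completing a square. *)
have abs_le : `|u| <= 2 * (e + e * u ^+ 2 + (e <= u)%R%:R / (4 * e)) - u.
  have eu2 : 0 <= e * u ^+ 2 by rewrite mulr_ge0 ?sqr_ge0// ltW.
  have [eu|ue] := leP e u.
    have u0 : 0 <= u by lra.
    rewrite ger0_norm// mul1r.
    have : 0 <= (2 * e * u - 1) ^+ 2 / (4 * e).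
      by rewrite divr_ge0 ?sqr_ge0// mulr_ge0// ltW.
    have -> : (2 * e * u - 1) ^+ 2 / (4 * e) = e * u ^+ 2 - u + (4 * e)^-1.
      by field; rewrite gt_eqF.
    lra.
  rewrite mul0r addr0; have [u0|u0] := leP 0 u; first by rewrite ger0_norm//; lra.
  by rewrite ltr0_norm//; lra.
have : u * g <= L * `|u| + (8^-1 * u ^+ 2 + 2 / L ^+ 2 * g ^+ 4).
  have g4 : 0 <= g ^+ 4 by rewrite -[4%N]/(2 * 2)%N exprM sqr_ge0.
  have rest : 0 <= 8^-1 * u ^+ 2 + 2 / L ^+ 2 * g ^+ 4.
    by rewrite addr_ge0// mulr_ge0 ?sqr_ge0// divr_ge0// sqr_ge0.
  have ug : u * g <= `|u| * `|g| by rewrite -normrM ler_norm.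
  (* Where [g] exceeds [L] in absolute value, the product is at most [u ^+ 2 / 8 + 2 * g ^+ 2], and
     [g ^+ 2] is at most [g ^+ 4 / L ^+ 2]. *)
  have [gL|Lg] := leP `|g| L.
    have : `|u| * `|g| <= L * `|u| by rewrite mulrC ler_wpM2r.
    lra.
  have Lu : 0 <= L * `|u| by rewrite mulr_ge0// ltW.
  have sq : L ^+ 2 <= g ^+ 2.
    by rewrite -(real_normK (num_real g)) lerXn2r ?nnegrE// ltW.
  have g24 : g ^+ 2 <= g ^+ 4 / L ^+ 2.
    rewrite ler_pdivlMr ?exprn_gt0// -[4%N]/(2 + 2)%N exprD.
    by rewrite ler_wpM2l ?sqr_ge0.
  have := sqr_ge0 (`|u| - 4 * `|g|).
  have u2 := real_normK (num_real u); have g2 := real_normK (num_real g).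
  have -> : (`|u| - 4 * `|g|) ^+ 2 = u ^+ 2 - 8 * (`|u| * `|g|) + 16 * g ^+ 2.
    by rewrite -u2 -g2; ring.
  have -> : 2 / L ^+ 2 * g ^+ 4 = 2 * (g ^+ 4 / L ^+ 2) by ring.
  lra.
have := ler_wpM2l (ltW L0) abs_le.
lra.
Qed.

Variable xi : nat -> Omega -> R.
Hypothesis mxi : forall k, measurable_fun setT (xi k).
Hypothesis indxi : mutually_independent P xi.
Hypothesis xi1 : forall k, has_mean P (xi k) 0.
Hypothesis xi2 : forall k, has_mean P (fun w => xi k w ^+ 2) 1.

(* Uniform square integrability of the [xi k] prevents the normalised sums from
   concentrating at [0]: testing the sum against the sum of the truncations gives
   a lower bound for its [L^1] norm, hence, the mean being zero, for the mass it
   puts to the right of a small positive number. *)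
Lemma sum_anticoncentration (M : R) : 0 <= M ->
  (forall k, 2^-1 <= \int[P]_w (xi k w * trunc M (xi k w))) ->
  exists e delta : R, [/\ 0 < e, 0 < delta &
    forall n (b : nat -> R), \sum_(k < n) b k ^+ 2 = 1 ->
      delta <= fine (P [set w | e <= \sum_(k < n) b k * xi k w])].
Proof.
move=> M0 hM.
pose m k := \int[P]_w trunc M (xi k w).
(* The truncation is centred because the fourth moment bound requires mean 0. *)
pose g k x := trunc M x - m k.
have mtr k : measurable_fun setT (fun w => trunc M (xi k w)).
  by apply: measurableT_comp => //; exact: measurable_trunc.
have tr1 k : has_mean P (fun w => trunc M (xi k w)) (m k).
  by apply: (@has_mean_bounded _ _ _ _ _ M) => // w; exact: trunc_le.
have mM k : `|m k| <= M.
  apply/ler_normlP; split.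
    have := has_mean_le (has_mean_cst P (- M)) (tr1 k).
    rewrite lerNl; apply => w.
    by have /ler_normlP[] := trunc_le (xi k w) M0; rewrite lerNl.
  apply: has_mean_le (tr1 k) (has_mean_cst P M) _ => w.
  by have /ler_normlP[] := trunc_le (xi k w) M0.
have mg k : measurable_fun setT (g k).
  by apply: measurable_funB => //; exact: measurable_trunc.
have gK k x : `|g k x| <= 2 * M.
  rewrite (le_trans (ler_normB _ _))// mulr2n mulrDl mul1r lerD//.
  exact: trunc_le.
have g1 k : has_mean P (g k \o xi k) 0.
  apply: eq_has_mean (has_meanD (tr1 k) (has_mean_cst P (- m k))) _ _ => //.
  by rewrite subrr.
have xitr k : has_mean P (fun w => xi k w * trunc M (xi k w))
    (\int[P]_w (xi k w * trunc M (xi k w))).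
  apply: (@has_mean_dominated _ _ _ _ _ (fun w => xi k w ^+ 2) 1) => //.
    exact: measurable_funM.
  by move=> w; rewrite ger0_norm ?trunc_mul_ge0// trunc_mul_le.
(* Centring does not change this mean, since [xi k] itself has mean 0. *)
have xig k : has_mean P (fun w => xi k w * g k (xi k w))
    (\int[P]_w (xi k w * trunc M (xi k w))).
  apply: eq_has_mean (has_meanD (xitr k) (has_meanZ (- m k) (xi1 k))) _ _ => [w|].
    by rewrite /g; ring.
  by rewrite mulr0 addr0.
(* [C] bounds the fourth moment of [G]; [L] is large enough for [2 / L ^+ 2 * C <= 8^-1]; and [e] is
   chosen so that [L * e] is 1/32. *)
pose C := 3 * (2 * M) ^+ 4.
have C0 : 0 <= C by rewrite mulr_ge0// exprn_ge0// mulr_ge0.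
pose L := 1 + 16 * C.
have L0 : 0 < L by rewrite /L; lra.
pose e := (32 * L)^-1.
have e0 : 0 < e by rewrite invr_gt0 mulr_gt0.
exists e, (e / (4 * L)); split => //; first by rewrite divr_gt0// mulr_gt0.
move=> n b b1.
set U := fun w => \sum_(k < n) b k * xi k w.
set G := fun w => \sum_(k < n) b k * g k (xi k w).
set p := fine _.
have U1 : has_mean P U 0 := has_mean_sum b n xi1.
have U2 : has_mean P (fun w => U w ^+ 2) 1.
  apply: eq_has_mean (has_mean_sum_sqr mxi indxi xi1 xi2 b n) _ _ => //.
  by rewrite -[RHS]b1; apply: eq_bigr => k _; rewrite mulr1.
have UG : has_mean P (fun w => U w * G w)
    (\sum_(k < n) b k ^+ 2 * \int[P]_w (xi k w * trunc M (xi k w))).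
  exact: (has_mean_sum_mul mxi indxi xi1 b mg g1 xig n).
have mG : measurable_fun setT G.
  exact: has_mean_measurable (has_mean_sum b n g1).
have G4 : has_mean P (fun w => G w ^+ 4) (\int[P]_w (G w ^+ 4)).
  apply: (@has_mean_bounded _ _ _ _ _ ((\sum_(k < n) `|b k| * (2 * M)) ^+ 4)).
    exact: measurable_funX.
  move=> w; have GK : `|G w| <= \sum_(k < n) `|b k| * (2 * M).
    apply: le_trans (ler_norm_sum _ _ _) _; apply: ler_sum => k _.
    by rewrite normrM ler_wpM2l.
  by rewrite normrX lerXn2r ?nnegrE// (le_trans _ GK).
have G4C : \int[P]_w (G w ^+ 4) <= C.
  have := @mean_sum_bounded_exp4 _ _ _ _ _ mxi indxi b _ mg _ gK g1 n.
  by rewrite b1 expr1n mulr1.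
have mE : measurable [set w | e <= U w].
  have := has_mean_measurable U1 => mU.
  rewrite (_ : [set w | _] = U @^-1` `[e, +oo[%classic).
    by rewrite -[X in measurable X]setTI; apply: mU.
  by apply/seteqP; split=> w /=; rewrite in_itv/= andbT.
have hi := has_mean_indic P mE.
have rhs := has_meanD (has_meanD (has_meanZ L (has_meanD
    (has_meanZ 2 (has_meanD (has_meanD (has_mean_cst P e) (has_meanZ e U2))
      (has_meanZ (4 * e)^-1 hi))) (has_meanZ (-1) U1)))
    (has_meanZ 8^-1 U2)) (has_meanZ (2 / L ^+ 2) G4).
have := has_mean_le UG rhs.
rewrite -/p.
(* The inequality being integrated is [duality_bound] at [U w] and [G w]. *)
have -> : (forall w, U w * G w <= L * (2 * (e + e * U w ^+ 2
      + (4 * e)^-1 * \1_[set w | e <= U w] w) + -1 * U w)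
    + 8^-1 * U w ^+ 2 + 2 / L ^+ 2 * G w ^+ 4) = True.
  rewrite propeqE; split => // _ w.
  have -> : \1_[set w | e <= U w] w = (e <= U w)%R%:R :> R.
    by rewrite indicE; congr (nat_of_bool _)%:R; apply/idP/idP; rewrite inE.
  rewrite [(4 * e)^-1 * _]mulrC mulN1r.
  exact: duality_bound.
move=> /(_ I).
have lower : 2^-1 <= \sum_(k < n) b k ^+ 2 * \int[P]_w (xi k w * trunc M (xi k w)).
  have -> : 2^-1 = \sum_(k < n) b k ^+ 2 * 2^-1 by rewrite -mulr_suml b1 mul1r.
  apply: ler_sum => k _.
  by rewrite ler_wpM2l ?sqr_ge0.
move=> /(le_trans lower).
have L2 : 2 / L ^+ 2 * \int[P]_w (G w ^+ 4) <= 8^-1.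
  rewrite mulrAC ler_pdivrMr ?exprn_gt0//.
  apply: (@le_trans _ _ (2 * C)); first by rewrite ler_wpM2l.
  rewrite /L; have := sqr_ge0 (16 * C); lra.
have Le : L * e = 32^-1 by rewrite /e; field; rewrite gt_eqF.
have e4 : (4 * e)^-1 = 8 * L by rewrite /e; field; rewrite gt_eqF.
rewrite e4 mulr1 !mulr0 addr0.
(* The integrated inequality is now 1/2 at most [4 * (L * e) + 16 * L ^+ 2 * p] plus two terms of at
   most 1/8 each. Hence [L ^+ 2 * p] is at least 1/128, which is the claimed bound on [p]. *)
have -> : L * (2 * (e + e + 8 * L * p)) = 4 * (L * e) + 16 * L ^+ 2 * p by ring.
rewrite Le => main.
rewrite ler_pdivrMr ?mulr_gt0//.
rewrite -(ler_pM2l L0) Le.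
have -> : L * (p * (4 * L)) = 4 * (L ^+ 2 * p) by ring.
lra.
Qed.

End anticoncentration.

(** * Independent events and half spaces *)

Section independent_events.
Context {R : realType} d (Omega : measurableType d) (P : probability Omega R).
Variable E : nat -> set Omega.
Hypothesis mE : forall k, measurable (E k).
Let p k := fine (P (E k)).
Hypothesis indE : forall s, uniq s ->
  fine (P (\big[setI/setT]_(k <- s) E k)) = \prod_(k <- s) p k.

(** Induction on the complemented list: the probability of meeting the complement of [E k] is a
    difference of two probabilities with one complement fewer, the second having [k] moved to
    [s1]. *)
Lemma independent_events_setC s1 s2 : uniq (s1 ++ s2) ->
  fine (P (\big[setI/setT]_(k <- s1) E k `&` \big[setI/setT]_(k <- s2) ~` E k))
  = (\prod_(k <- s1) p k) * \prod_(k <- s2) (1 - p k).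
Proof.
elim: s2 s1 => [|k s2 IH] s1 us; first by rewrite !big_nil setIT mulr1 indE// -[s1]cats0.
have us' : uniq ((k :: s1) ++ s2) by rewrite -(cat1s k s1) -catA uniq_catCA.
have us'' : uniq (s1 ++ s2) by have /andP[] := us'.
have mI s : measurable (\big[setI/setT]_(k <- s) E k) by exact: bigsetI_measurable.
have mIC s : measurable (\big[setI/setT]_(k <- s) ~` E k).
  by apply: bigsetI_measurable => j _; exact: measurableC.
rewrite [in LHS]big_cons setICA setIC -setDE.
have mI12 : measurable (\big[setI/setT]_(k <- s1) E k `&`
    \big[setI/setT]_(k <- s2) ~` E k) by exact: measurableI.
have mI12k := measurableI _ _ mI12 (mE k).
rewrite measureD//; last by rewrite ltey_eq fin_num_measure.
rewrite fineB ?fin_num_measure// IH//.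
have -> : \big[setI/setT]_(k <- s1) E k `&` \big[setI/setT]_(k <- s2) ~` E k `&` E k
  = \big[setI/setT]_(k <- k :: s1) E k `&` \big[setI/setT]_(k <- s2) ~` E k.
  by rewrite big_cons setIC setIA.
by rewrite IH// !big_cons; ring.
Qed.

(** All [m] events from index [N] on fail with probability at most [(1 - delta) ^+ m], which tends
    to 0. *)
Lemma independent_events_occur (delta : R) (N : nat) : 0 < delta ->
  (forall k, (N <= k)%N -> delta <= p k) ->
  {ae P, forall w, exists k, E k w}.
Proof.
move=> delta0 deltap.
have mC : measurable (\bigcap_k ~` E k).
  by apply: bigcapT_measurable => k; exact: measurableC.
exists (\bigcap_k ~` E k); split => //; last first.
  by move=> w /= nE k _ Ek; apply: nE; exists k.
suff : fine (P (\bigcap_k ~` E k)) = 0.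
  by move=> h; rewrite -[LHS]fineK ?fin_num_measure// h.
have p1 k : p k <= 1 by rewrite /p -lee_fin fineK ?fin_num_measure// probability_le1.
have delta1 : delta <= 1 by exact: le_trans (deltap N (leqnn _)) (p1 N).
have bound m : fine (P (\bigcap_k ~` E k)) <= (1 - delta) ^+ m.
  apply: (@le_trans _ _ (fine (P (\big[setI/setT]_(k <- iota N m) ~` E k)))).
    have mI : measurable (\big[setI/setT]_(k <- iota N m) ~` E k).
      by apply: bigsetI_measurable => j _; exact: measurableC.
    rewrite fine_le ?fin_num_measure// le_measure ?inE//.
    by rewrite -bigcap_seq => w nE k _; exact: nE.
  have := @independent_events_setC [::] (iota N m) (iota_uniq _ _).
  rewrite !big_nil setTI mul1r => ->.
  rewrite -[m in leRHS](size_iota N m) -iter_mulr_1 -count_predT -big_const_seq.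
  rewrite big_seq [leRHS]big_seq; apply: ler_prod => k.
  by rewrite mem_iota => /andP[Nk _]; rewrite subr_ge0 p1 lerB// deltap.
apply/eqP; rewrite eq_le fine_ge0// andbT.
have : (1 - delta) ^+ m @[m --> \oo] --> (0 : R).
  by apply: cvg_expr; rewrite ger0_norm ?subr_ge0// gtrBl.
move=> cv; rewrite -(cvg_lim (@Rhausdorff R) cv).
by apply: limr_ge; [apply/cvg_ex; exists 0|apply: nearW].
Qed.

End independent_events.

(** * Events shared by several i.i.d. copies *)

Section iid_events.
Context {R : realType} d (Omega : measurableType d) (P : probability Omega R).
Context d' (T : measurableType d') (X : {RV P >-> T}) (Xs : nat -> {RV P >-> T}).
Hypothesis hXs : iid_copies X Xs.
Variable A : nat -> set T.
Hypothesis mA : forall k, measurable (A k).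
Hypothesis indA : forall s, uniq s ->
  fine (P (X @^-1` \bigcap_(k in [set` s]) A k)) = \prod_(k <- s) fine (P (X @^-1` A k)).

(** For fixed [n], the events that the first [n] copies all fall in [A k] are independent in [k],
    with probabilities at least [delta ^+ n] from [N] on. Only countably many [n] are involved. *)
Lemma iid_events_occur (delta : R) (N : nat) : 0 < delta ->
  (forall k, (N <= k)%N -> delta <= fine (P (X @^-1` A k))) ->
  {ae P, forall w, forall n, exists k, forall j, (j < n)%N -> A k (Xs j w)}.
Proof.
move=> delta0 deltap; apply/ae_foralln => n.
case: hXs => indXs lawXs.
have mI (s : seq nat) : measurable (\bigcap_(k in [set` s]) A k).
  by rewrite bigcap_seq; exact: bigsetI_measurable.
pose E k := \bigcap_(j in [set` iota 0 n]) (Xs j @^-1` A k).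
have mpre j (B : set T) : measurable B -> measurable (Xs j @^-1` B).
  by move=> mB; rewrite -[X in measurable X]setTI; exact: measurable_funP.
have mE k : measurable (E k).
  by rewrite /E bigcap_seq; apply: bigsetI_measurable => j _; exact: mpre.
have PE (B : set T) : measurable B ->
    fine (P (\bigcap_(j in [set` iota 0 n]) (Xs j @^-1` B))) = fine (P (X @^-1` B)) ^+ n.
  move=> mB; have := @mutually_independent_seq _ _ _ P _ _ _ (iota 0 n) (fun=> B) indXs.
  move=> ->//; last exact: iota_uniq.
  rewrite -[in RHS](size_iota 0 n) -iter_mulr_1 -count_predT -big_const_seq.
  rewrite (eq_bigr (fun=> (fine (P (X @^-1` B)))%:E)) ?prodEFin// => j _.
  rewrite fineK; last by rewrite fin_num_measure//; exact: measurable_funPTI.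
  exact: lawXs.
have HE : {ae P, forall w, exists k, E k w}.
  apply: (@independent_events_occur _ _ _ _ _ mE _ (delta ^+ n) N).
  - move=> s us; rewrite -bigcap_seq.
    (* Exchanging the intersections uses independence of the copies first, giving an [n]-th power,
       and independence in [k] afterwards. *)
    have -> : \bigcap_(k in [set` s]) E k =
        \bigcap_(j in [set` iota 0 n]) (Xs j @^-1` \bigcap_(k in [set` s]) A k).
      by apply/seteqP; split=> w h i hi k hk; exact: h.
    rewrite PE// indA//.
    rewrite (big_morph (fun x : R => x ^+ n) (fun x y => exprMn n x y) (expr1n _ n)).
    apply: eq_bigr => k _.
    by rewrite PE.
  - by rewrite exprn_gt0.
  - move=> k Nk; rewrite PE//; apply: lerXn2r; rewrite ?nnegrE.
    + exact: ltW.
    + exact: fine_ge0.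
    + exact: deltap.
apply: (filterS _ HE) => w [k Ek]; exists k => j jn.
by apply: Ek; rewrite /= mem_iota.
Qed.

End iid_events.

(** * Probabilities of half spaces *)

Section half_spaces.
Context {R : realType} d (Omega : measurableType d) (P : probability Omega R).
Variable Y : nat -> Omega -> R.
Hypothesis mY : forall k, measurable_fun setT (Y k).
Hypothesis indY : mutually_independent P Y.
Variables (sigma alpha : nat -> R).
Hypothesis sigma0 : forall k, 0 < sigma k.

Lemma measurable_half_space n (c : nat -> R) (x : R) (D : pred nat) :
  measurable [set w | x <= \sum_(k < n | D k) c k * Y k w].
Proof.
have mS : measurable_fun setT (fun w => \sum_(k < n | D k) c k * Y k w).
  under eq_fun do rewrite big_mkcond/=.
  apply: measurable_sum => k; case: (D k); last exact: measurable_cst.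
  exact: measurable_funM.
rewrite (_ : [set w | _] = (fun w => \sum_(k < n | D k) c k * Y k w) @^-1` `[x, +oo[%classic).
  by rewrite -[X in measurable X]setTI; apply: mS.
by apply/seteqP; split=> w /=; rewrite in_itv/= andbT.
Qed.

(** With the coefficients [alpha k / sigma k ^+ 2], the threshold and the variance of the sum are
    the same number [s], so Chebyshev gives [s ^+ 2 * p <= s]. The product form also covers
    [s = 0]. *)
Lemma half_space_chebyshev n :
  (forall k, has_mean P (Y k) 0) ->
  (forall k, has_mean P (fun w => Y k w ^+ 2) (sigma k ^+ 2)) ->
  fine (P [set w | \sum_(k < n) alpha k / sigma k ^+ 2 * alpha k <=
                   \sum_(k < n) alpha k / sigma k ^+ 2 * Y k w])
    * (\sum_(k < n) alpha k ^+ 2 / sigma k ^+ 2) <= 1.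
Proof.
move=> Y1 Y2; pose c k := alpha k / sigma k ^+ 2.
set s := \sum_(k < n) alpha k ^+ 2 / sigma k ^+ 2.
have -> : \sum_(k < n) c k * alpha k = s.
  by apply: eq_bigr => k _; rewrite /c mulrAC -expr2.
set p := fine _.
have [s0|s0] := leP s 0.
  by rewrite (@le_trans _ _ 0)// mulr_ge0_le0// fine_ge0.
have S2 := has_mean_sum_sqr mY indY Y1 Y2 c n.
have mS := measurable_half_space n c s xpredT.
have := has_mean_le (has_meanZ (s ^+ 2) (has_mean_indic P mS)) S2.
have -> : \sum_(k < n) c k ^+ 2 * sigma k ^+ 2 = s.
  by apply: eq_bigr => k _; rewrite /c; field; rewrite gt_eqF.
rewrite -/p => H; have : s ^+ 2 * p <= s.
  apply: H => w; rewrite indicE; case: (boolP (w \in _)); last first.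
    by rewrite mulr0 sqr_ge0.
  rewrite inE /= mulr1 => sS; apply: lerXn2r => //; rewrite nnegrE.
    exact: ltW.
  exact: le_trans (ltW s0) sS.
by rewrite expr2 -mulrA -[X in _ <= X]mulr1 ler_pM2l// mulrC.
Qed.

(** The half space contains the intersection of a head event and a tail event, which are independent
    and each have mass bounded below uniformly in the coefficients. *)
Lemma half_space_lower_bound (e delta : R) (N0 : nat) :
  0 < e -> 0 < delta ->
  (exists2 h : R, 0 < h & forall c : nat -> R, h <= fine (P
     [set w | \sum_(k < N0) c k * alpha k <= \sum_(k < N0) c k * Y k w])) ->
  (forall n (b : nat -> R), \sum_(k < n) b k ^+ 2 = 1 ->
     delta <= fine (P [set w | e <= \sum_(k < n) b k * (Y k w / sigma k)])) ->
  (forall n, \sum_(k < n | ~~ (k < N0)%N) alpha k ^+ 2 / sigma k ^+ 2 <= e ^+ 2) ->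
  exists2 eta : R, 0 < eta & forall n (c : nat -> R), eta <= fine (P
     [set w | \sum_(k < n) c k * alpha k <= \sum_(k < n) c k * Y k w]).
Proof.
move=> e0 delta0 [h h0 head] tail small.
exists (h * Num.min delta 1); first by rewrite mulr_gt0// lt_min delta0/=.
move=> n c0.
(* Padding the coefficients with zeros makes the head always consist of exactly [N0] terms, even
   when [n < N0]. *)
pose N := (n + N0)%N.
pose c k := if (k < n)%N then c0 k else 0.
have reduce (F : nat -> R) : \sum_(k < n) c0 k * F k = \sum_(k < N) c k * F k.
  rewrite (big_ord_widen N (fun k => c0 k * F k)) ?leq_addr// big_mkcond.
  by apply: eq_bigr => k _; rewrite /c; case: ifP; rewrite ?mul0r.
rewrite reduce; under [X in P X]eq_set => w do rewrite (reduce (Y ^~ w)).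
pose Hd (F : nat -> R) := \sum_(k < N | (k < N0)%N) c k * F k.
pose Tl (F : nat -> R) := \sum_(k < N | ~~ (k < N0)%N) c k * F k.
have split_sum (F : nat -> R) : \sum_(k < N) c k * F k = Hd F + Tl F.
  by rewrite (bigID (fun k : 'I_N => k < N0)%N).
pose A := [set w | Hd alpha <= Hd (Y ^~ w)].
pose B := [set w | Tl alpha <= Tl (Y ^~ w)].
have mA : measurable A := measurable_half_space N c (Hd alpha) (fun k => k < N0)%N.
have mTl (x : R) : measurable [set w | x <= Tl (Y ^~ w)].
  exact: (measurable_half_space N c x (fun k => ~~ (k < N0))%N).
have mB : measurable B by exact: mTl.
have HdE (F : nat -> R) : Hd F = \sum_(k < N0) c k * F k.
  by rewrite /Hd (big_ord_widen N (fun k => c k * F k)) ?leq_addl.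
have PA : h <= fine (P A).
  by rewrite /A; under eq_set => w do rewrite !HdE; exact: head.
have PB : Num.min delta 1 <= fine (P B).
  pose v := \sum_(k < N | ~~ (k < N0)%N) (c k * sigma k) ^+ 2.
  (* If the tail coefficients all vanish there is nothing to normalise and the tail event is
     certain; this is the reason for the minimum with 1. *)
  have [v0|v0] := eqVneq v 0.
    have Tl0 (F : nat -> R) : Tl F = 0.
      rewrite /Tl big1// => k kN0.
      have := psumr_eq0P (fun (i : 'I_N) _ => sqr_ge0 (c i * sigma i)) v0 kN0.
      by move=> /eqP; rewrite sqrf_eq0 mulf_eq0 (gt_eqF (sigma0 k)) orbF => /eqP ->; rewrite mul0r.
    have -> : B = setT by apply/seteqP; split => // w _; rewrite /B/= !Tl0.
    by rewrite probability_setT /= ge_min lexx orbT.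
  have vge0 : 0 <= v by apply: sumr_ge0 => k _; exact: sqr_ge0.
  have vgt0 : 0 < v by rewrite lt_def v0.
  pose r := Num.sqrt v.
  have r0 : 0 < r by rewrite sqrtr_gt0.
  have rE : r ^+ 2 = v by rewrite sqr_sqrtr.
  (* Normalised tail coefficients, extended by 0 over the head so that the anticoncentration
     hypothesis applies to the full range [k < N]. *)
  pose b k := if (k < N0)%N then 0 else c k * sigma k / r.
  have b1 : \sum_(k < N) b k ^+ 2 = 1.
    rewrite -[RHS](@mulfV _ v)// {1}/v mulr_suml -rE big_mkcond [RHS]big_mkcond.
    apply: eq_bigr => k _; rewrite /b; case: ifP => /= _; first by rewrite expr0n.
    by rewrite exprMn exprVn.
  have bE (F : nat -> R) : r * \sum_(k < N) b k * (F k / sigma k) = Tl F.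
    rewrite mulr_sumr /Tl [RHS]big_mkcond; apply: eq_bigr => k _.
    rewrite /b; case: ifP => /= _; first by rewrite mul0r mulr0.
    by field; rewrite !gt_eqF.
  (* Cauchy-Schwarz in additive form: [x * y] is at most [e / 2 * x ^+ 2 + (2 * e)^-1 * y ^+ 2], and
     the two sums contribute at most [e / 2] each. *)
  have alpha_le : \sum_(k < N) b k * (alpha k / sigma k) <= e.
    apply: (@le_trans _ _ (\sum_(k < N) (e / 2 * b k ^+ 2 +
        (2 * e)^-1 * (if (k < N0)%N then 0 else alpha k ^+ 2 / sigma k ^+ 2)))).
      apply: ler_sum => k _; rewrite /b; case: ifP => _.
        by rewrite mul0r expr0n /= !mulr0 addr0.
      set x := c k * _ / _; set y := alpha k / sigma k.
      have -> : alpha k ^+ 2 / sigma k ^+ 2 = y ^+ 2 by rewrite /y exprMn exprVn.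
      have : 0 <= (e * x - y) ^+ 2 / (2 * e) by rewrite divr_ge0 ?sqr_ge0// mulr_ge0// ltW.
      have -> : (e * x - y) ^+ 2 / (2 * e) = e / 2 * x ^+ 2 + (2 * e)^-1 * y ^+ 2 - x * y.
        by field; rewrite gt_eqF.
      by rewrite subr_ge0.
    rewrite big_split /= -!mulr_sumr b1 mulr1.
    have sm : \sum_(k < N) (if (k < N0)%N then 0 else alpha k ^+ 2 / sigma k ^+ 2) <= e ^+ 2.
      apply: le_trans (small N); rewrite [leRHS]big_mkcond; apply: ler_sum => k _.
      by case: ltnP.
    have e2 : 0 <= (2 * e)^-1 by rewrite invr_ge0 mulr_ge0// ltW.
    have eE : e / 2 + (2 * e)^-1 * e ^+ 2 = e by field; rewrite gt_eqF.
    by rewrite -[leRHS]eE lerD2l ler_wpM2l.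
  rewrite ge_min; apply/orP; left; apply: le_trans (tail N b b1) _.
  have -> : [set w | e <= \sum_(k < N) b k * (Y k w / sigma k)] =
      [set w | r * e <= Tl (Y ^~ w)].
    by apply/seteqP; split=> w /=; rewrite -(bE (Y ^~ w)) ler_pM2l.
  rewrite fine_le ?fin_num_measure// le_measure ?inE// => w /=.
  by apply: le_trans; rewrite -bE ler_pM2l.
have indAB : P (A `&` B) = (P A * P B)%E.
  have mc k : measurable_fun setT (fun y : R => c k * y).
    by apply: measurable_funM => //; exact: measurable_id.
  have ind := @independent_sums _ _ _ P _ mY indY N (fun k => k < N0)%N
    (fun k y => c k * y) (fun k y => c k * y) mc mc.
  have := ind `[Hd alpha, +oo[%classic `[Tl alpha, +oo[%classic (measurable_itv _)
    (measurable_itv _).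
  have itvE (u : R) (F : Omega -> R) : F @^-1` `[u, +oo[%classic = [set w | u <= F w].
    by apply/seteqP; split=> w /=; rewrite in_itv/= andbT.
  by rewrite !itvE.
apply: (@le_trans _ _ (fine (P (A `&` B)))).
  rewrite indAB fineM ?fin_num_measure// ler_pM//; first exact: ltW.
  by rewrite le_min ltW//= ler01.
have mAB : measurable [set w | \sum_(k < N) c k * alpha k <= \sum_(k < N) c k * Y k w].
  exact: (measurable_half_space N c _ xpredT).
rewrite fine_le ?fin_num_measure ?le_measure ?inE//; try exact: measurableI.
move=> w [/= Aw Bw]; rewrite !split_sum (split_sum (Y ^~ w)).
exact: lerD.
Qed.

End half_spaces.

(** * Moment and density conditions *)

Section moment_conditions.
Context {R : realType} d (Omega : measurableType d) (P : probability Omega R).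

Lemma ge0_has_mean (f : Omega -> R) (m : R) : measurable_fun setT f ->
  (forall w, 0 <= f w) -> (\int[P]_w (f w)%:E = m%:E)%E -> has_mean P f m.
Proof.
move=> mf f0 fm; split; last by rewrite /Rintegral fm.
apply/integrableP; split; first exact/measurable_EFinP.
under eq_integral => w _ do rewrite gee0_abs ?lee_fin//.
by rewrite fm ltry.
Qed.

Lemma expectation_has_mean (f : Omega -> R) (m : R) :
  P.-integrable setT (EFin \o f) -> ('E_P[f] = m%:E)%E -> has_mean P f m.
Proof. by move=> fi; rewrite unlock => fm; split=> //; rewrite /Rintegral fm. Qed.

Lemma variance_has_mean (f : Omega -> R) (m : R) :
  measurable_fun setT f -> ('E_P[f] = 0)%E -> ('V_P[f] = m%:E)%E ->
  has_mean P (fun w => f w ^+ 2) m.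
Proof.
move=> mf f0; rewrite /variance unlock f0 unlock => fm.
apply: ge0_has_mean => [|w|]; [exact: measurable_funX|exact: sqr_ge0|].
rewrite -fm; apply: eq_integral => w _.
by change ((f w ^+ 2)%:E = ((f w - 0) * (f w - 0))%:E); rewrite subr0.
Qed.

(** Both means are integrals of [f] against the common image law. *)
Lemma has_mean_same_law (U V : Omega -> R) (f : R -> R) m :
  measurable_fun setT U -> measurable_fun setT V -> measurable_fun setT f ->
  (forall A, measurable A -> P (U @^-1` A) = P (V @^-1` A)) ->
  has_mean P (f \o U) m -> has_mean P (f \o V) m.
Proof.
move=> mU mV mf UV [fi fm].
pose U' : {mfun Omega >-> R} := mfun_Sub (mem_set mU).
pose V' : {mfun Omega >-> R} := mfun_Sub (mem_set mV).
have mEf : measurable_fun setT (EFin \o f) by exact/measurable_EFinP.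
have lawE A : measurable A -> A `<=` setT -> distribution P U' A = distribution P V' A.
  by move=> mA _; exact: UV.
have fVi : P.-integrable setT (EFin \o (f \o V)).
  apply/integrableP; split; first by apply/measurable_EFinP; exact: measurableT_comp.
  case/integrableP : fi => _.
  rewrite -(@ge0_integral_distribution _ _ _ _ _ _ U' (fun x => `|(f x)%:E|%E))//; last first.
    exact/measurableT_comp.
  rewrite -(@ge0_integral_distribution _ _ _ _ _ _ V' (fun x => `|(f x)%:E|%E))//; last first.
    exact/measurableT_comp.
  by rewrite (eq_measure_integral _ lawE).
split=> //; rewrite -fm /Rintegral; congr fine.
rewrite -(@integral_distribution _ _ _ _ _ _ U' (EFin \o f))//.
rewrite -(@integral_distribution _ _ _ _ _ _ V' (EFin \o f))//.
by rewrite (eq_measure_integral _ lawE).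
Qed.

(** Where truncation acts, [f ^+ 2] is at most [f ^+ 4 / M ^+ 2], so the loss in second moment is at
    most [c / M ^+ 2], which is below 1/2 for this [M]. *)
Lemma mean_trunc_exp4 (f : Omega -> R) (c m4 : R) :
  has_mean P (fun w => f w ^+ 2) 1 -> has_mean P (fun w => f w ^+ 4) m4 ->
  measurable_fun setT f -> m4 <= c -> forall M, 1 + 2 * `|c| <= M ->
  2^-1 <= \int[P]_w (f w * trunc M (f w)).
Proof.
move=> f2 f4 mf m4c M cM.
have c0 : 0 <= `|c| by [].
have M0 : 0 < M by lra.
have mtr : measurable_fun setT (fun w => trunc M (f w)).
  by apply: measurableT_comp => //; exact: measurable_trunc.
have tr : has_mean P (fun w => f w * trunc M (f w)) (\int[P]_w (f w * trunc M (f w))).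
  apply: (@has_mean_dominated _ _ _ _ _ (fun w => f w ^+ 2) 1) => //.
    exact: measurable_funM.
  by move=> w; rewrite ger0_norm ?trunc_mul_ge0// trunc_mul_le.
have := has_mean_le f2 (has_meanD tr (has_meanZ (M ^- 2) f4)).
set I := \int[P]_w _.
have le2 : M ^- 2 * m4 <= 2^-1.
  rewrite mulrC ler_pdivrMr ?exprn_gt0//.
  have := ler_norm c.
  have : (1 + 2 * `|c|) ^+ 2 <= M ^+ 2.
    by apply: lerXn2r => //; rewrite nnegrE; lra.
  have := sqr_ge0 `|c|.
  lra.
move=> H; suff : 1 <= I + M ^- 2 * m4 by lra.
apply: H => w; rewrite /trunc; case: ifPn => [_|].
  rewrite -expr2 lerDl; apply: mulr_ge0; first by rewrite invr_ge0 sqr_ge0.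
  by rewrite -[4%N]/(2 * 2)%N exprM sqr_ge0.
rewrite -ltNge mulr0 add0r => Mf.
rewrite mulrC ler_pdivlMr ?exprn_gt0// -[4%N]/(2 + 2)%N exprD ler_wpM2l ?sqr_ge0//.
rewrite -(real_normK (num_real (f w))); apply: lerXn2r; rewrite ?nnegrE//; exact: ltW.
Qed.

(** By dominated convergence the truncated second moments tend to 1 as the level grows, so they
    eventually exceed 1/2. *)
Lemma exists_mean_trunc (f : Omega -> R) :
  has_mean P (fun w => f w ^+ 2) 1 -> measurable_fun setT f ->
  exists2 M, 0 <= M & 2^-1 <= \int[P]_w (f w * trunc M (f w)).
Proof.
move=> f2 mf.
have mtr (n : nat) : measurable_fun setT (fun w => f w * trunc n%:R (f w)).
  by apply: measurable_funM => //; apply: measurableT_comp => //; exact: measurable_trunc.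
case: (f2) => f2i _.
pose f_ (n : nat) w := (f w * trunc n%:R (f w))%:E.
have cv : (\int[P]_w f_ n w @[n --> \oo] --> \int[P]_w (f w ^+ 2)%:E)%E.
  have [] // := @dominated_convergence _ Omega R P setT measurableT f_
    (fun w => (f w ^+ 2)%:E) (fun w => (f w ^+ 2)%:E).
  - by move=> n; apply/measurable_EFinP; exact: mtr.
  - exact: measurable_int f2i.
  - apply/aeW => w _; apply: cvg_near_cst.
    exists (Num.truncn `|f w|).+1 => // n /= fn.
    rewrite /f_ /trunc ifT ?expr2// ltW// (lt_le_trans (truncnS_gt _))//.
    by rewrite ler_nat.
  - apply/aeW => w n _; rewrite lee_fin ger0_norm ?trunc_mul_ge0//.
    exact: trunc_mul_le.
have cvR : \int[P]_w (f w * trunc n%:R (f w)) @[n --> \oo] --> \int[P]_w (f w ^+ 2).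
  apply: fine_cvg; rewrite fineK//; exact: integrable_fin_num.
rewrite (has_meanE f2) in cvR.
have [|N _ HN] := cvgr_gt _ cvR 2^-1; first by rewrite invf_lt1// ltr1n.
by exists N%:R => //; apply/ltW; exact: (HN N (leqnn N)).
Qed.

(** A nonnegative function with zero integral over [D] vanishes almost everywhere on [D]; as [phi]
    is positive almost everywhere, [D] would be null. *)
Lemma density_gt0 (phi : R -> R) (D : set R) :
  measurable_fun setT phi -> (forall x, 0 <= phi x) ->
  {ae lebesgue_measure, forall x : R, 0 < phi x} -> measurable D ->
  (0 < lebesgue_measure D)%E -> (0 < \int[lebesgue_measure]_(x in D) (phi x)%:E)%E.
Proof.
move=> mphi phi0 [N [mN N0 phiN]] mD D0.
rewrite lt0e integral_ge0 ?andbT; last by move=> x _; rewrite lee_fin.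
apply/negP => /eqP I0.
have mphiD : measurable_fun D (EFin \o phi).
  by apply/measurable_EFinP; exact: measurable_funS mphi.
have := (ae_eq_integral_abs lebesgue_measure mD mphiD).1.
rewrite (_ : (\int[lebesgue_measure]_(x in D) `|(EFin \o phi) x| = 0)%E); last first.
  by rewrite -[RHS]I0; apply: eq_integral => x _; rewrite gee0_abs// lee_fin.
move=> /(_ erefl)[N' [mN' N'0 phiN']].
have DNN : D `<=` N `|` N'.
  move=> x Dx; have [/eqP x0|x0] := boolP (phi x == 0).
    by left; apply: phiN => /=; rewrite x0 ltxx.
  by right; apply: phiN' => /=; move/(_ Dx) => /= [] /eqP; exact/negP.
have : (lebesgue_measure D <= 0)%E.
  rewrite -[leRHS](_ : lebesgue_measure (N `|` N') = 0)%E.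
    by rewrite le_measure ?inE//; exact: measurableU.
  by apply: null_set_setU.
by rewrite leNgt D0.
Qed.

(** Every half space through [alpha] contains an orthant with apex [alpha], picked by the signs of
    the coefficients. By independence its mass is a product of one-sided probabilities, and taking
    minima removes the dependence on the signs. *)
Lemma half_space_bound_of_orthants (Y : nat -> Omega -> R) (alpha : nat -> R) n :
  (forall k, measurable_fun setT (Y k)) -> mutually_independent P Y ->
  (forall k, 0 < fine (P [set w | alpha k <= Y k w])) ->
  (forall k, 0 < fine (P [set w | Y k w <= alpha k])) ->
  exists2 h : R, 0 < h & forall c : nat -> R, h <= fine (P
     [set w | \sum_(k < n) c k * alpha k <= \sum_(k < n) c k * Y k w]).
Proof.
move=> mY indY p0 q0.
pose p k := fine (P [set w | alpha k <= Y k w]).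
pose q k := fine (P [set w | Y k w <= alpha k]).
exists (\prod_(k <- iota 0 n) Num.min (p k) (q k)).
  by apply: prodr_gt0 => k _; rewrite lt_min p0 q0.
move=> c.
pose A k : set R := if 0 <= c k then `[alpha k, +oo[%classic else `]-oo, alpha k]%classic.
have mA k : measurable (A k) by rewrite /A; case: ifP.
have mYA k : measurable (Y k @^-1` A k) by rewrite -[X in measurable X]setTI; exact: mY.
have := @mutually_independent_seq _ _ _ P _ _ Y (iota 0 n) A indY (iota_uniq _ _) (fun k _ => mA k).
set B := \bigcap_(_ in _) _ => PB.
apply: (@le_trans _ _ (fine (P B))).
  rewrite PB (eq_bigr (fun k => (fine (P (Y k @^-1` A k)))%:E)); last first.
    by move=> k _; rewrite fineK// fin_num_measure.
  rewrite prodEFin /=; apply: ler_prod => k _; rewrite le_min !fine_ge0//=.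
  rewrite /A ge_min; case: ifP => _; apply/orP; [left|right].
    rewrite le_eqVlt; apply/orP; left; apply/eqP; congr (fine (P _)).
    by apply/seteqP; split=> w /=; rewrite in_itv/= andbT.
  rewrite le_eqVlt; apply/orP; left; apply/eqP; congr (fine (P _)).
have mB : measurable B by rewrite /B bigcap_seq; exact: bigsetI_measurable.
have mH := measurable_half_space mY n c (\sum_(k < n) c k * alpha k) xpredT.
rewrite fine_le ?fin_num_measure// le_measure ?inE// => w Bw /=.
apply: ler_sum => k _.
have := Bw k; rewrite /= mem_iota ltn_ord => /(_ isT); rewrite /A.
case: ifPn => [ck|]; rewrite /= in_itv/= ?andbT => Yk; first exact: ler_wpM2l.
by rewrite -ltNge in Yk *; move=> ck; apply: ler_wnM2l => //; exact: ltW.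
Qed.

End moment_conditions.

(** * Series tails and finite-dimensional depth *)

Section depth.
Context {R : realType}.

Lemma series_tail_le (f : nat -> R) (e : R) : (forall k, 0 <= f k) -> 0 < e ->
  (\sum_(0 <= k <oo) (f k)%:E < +oo)%E ->
  exists N : nat, forall n, \sum_(k < n | ~~ (k < N)%N) f k <= e.
Proof.
move=> f0 e0 foo.
have := @nneseries_tail_cvg R (fun k => (f k)%:E) xpredT foo
  (fun k _ => f0 k : (0 <= (f k)%:E)%E).
move=> /fine_cvgP[[N1 _ HN1] /cvgrPdist_le /(_ e e0)[N2 _ HN2]].
pose N := maxn N1 N2.
have fin := HN1 N (leq_maxl _ _); have := HN2 N (leq_maxr _ _).
rewrite /= sub0r normrN => le_e.
exists N => n.
rewrite (eq_bigl (fun k : 'I_n => true && (N <= k)%N)); last by move=> k; rewrite -leqNgt.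
rewrite -(big_geq_mkord N n xpredT f) -lee_fin.
apply: (@le_trans _ _ (\sum_(N <= k <oo) (f k)%:E)%E).
  by rewrite -sumEFin; apply: nneseries_lim_ge => k _; rewrite lee_fin.
by rewrite -(fineK fin) lee_fin (le_trans (ler_norm _) le_e).
Qed.

Context d (Omega : measurableType d) (P : probability Omega R).
Variables (B : topologicalLmodType R) (X : {RV P >-> borelType B}).
Variables (t : nat -> borelType B -> R) (a : borelType B).
Hypothesis mt : forall k, measurable_fun setT (t k).

(** The bound [h] is the depth itself: each coefficient vector defines a linear functional on row
    vectors, over which the depth is an infimum. *)
Lemma linear_depth_bound n :
  (0 < HD (@linear_functionals R n) (Pi t n a)
          (pushforward (distribution P X) (Pi t n)))%E ->
  exists2 h : R, 0 < h & forall c : nat -> R, h <= fine (P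
     [set w | \sum_(k < n) c k * t k a <= \sum_(k < n) c k * t k (X w)]).
Proof.
set H := HD _ _ _ => H0.
have HP (c : nat -> R) :
    (H <= P [set w | (\sum_(k < n) c k * t k a <= \sum_(k < n) c k * t k (X w))%R])%E.
  apply: ereal_inf_lbound; exists (fun x : 'rV[R]_n => \sum_(k < n) c k * x 0 k).
    move=> r x y; rewrite mulr_sumr -big_split /=; apply: eq_bigr => k _.
    by rewrite !mxE; ring.
  have PiE x : \sum_(k < n) c k * (Pi t n x) 0 k = \sum_(k < n) c k * t k x.
    by apply: eq_bigr => k _; rewrite mxE.
  by congr (P _); apply/seteqP; split=> w /=; rewrite !PiE.
have mY k : measurable_fun setT (t k \o X) by exact: measurableT_comp.
have mS (c : nat -> R) : measurable
    [set w | \sum_(k < n) c k * t k a <= \sum_(k < n) c k * t k (X w)].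
  exact: (measurable_half_space mY n c _ xpredT).
have Hfin : H \is a fin_num.
  rewrite ge0_fin_numE ?ltW//; apply: le_lt_trans (HP (fun=> 0)) _.
  by rewrite ltey_eq (fin_num_measure P _ (mS (fun=> 0))).
exists (fine H); first by rewrite fine_gt0// H0 ltey_eq Hfin.
by move=> c; apply: fine_le (HP c) => //; exact: (fin_num_measure P _ (mS c)).
Qed.

End depth.

(** * Consequences of the density condition *)

Section regular_density.
Context {R : realType} d (Omega : measurableType d) (P : probability Omega R).
Variables (Y : nat -> Omega -> R) (sigma : nat -> R).
Hypothesis mY : forall k, measurable_fun setT (Y k).
Hypothesis indY : mutually_independent P Y.
Hypothesis sigma0 : forall k, 0 < sigma k.
Hypothesis Y2 : forall k, has_mean P (fun w => Y k w ^+ 2) (sigma k ^+ 2).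
Hypothesis densY : iid_scaled_regular_density P Y.

(** Half-lines have infinite Lebesgue measure, so an almost everywhere positive density charges them
    all, and the orthant bound applies. *)
Lemma regular_density_half_space_bound (alpha : nat -> R) n :
  exists2 h : R, 0 < h & forall c : nat -> R, h <= fine (P
     [set w | \sum_(k < n) c k * alpha k <= \sum_(k < n) c k * Y k w]).
Proof.
case: densY => lambda [phi [lambda0 [_ [[mphi phi0 _] [dens [phipos _]]]]]].
have prob_gt0 k (A : set R) : measurable A -> (lebesgue_measure A = +oo)%E ->
    0 < fine (P ((fun w => Y k w / lambda k) @^-1` A)).
  move=> mA Aoo; rewrite fine_gt0//; apply/andP; split; last first.
    rewrite ltey_eq fin_num_measure// -[X in measurable X]setTI.
    by apply: measurable_funM.
  by rewrite dens//; apply: density_gt0 => //; rewrite Aoo.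
apply: half_space_bound_of_orthants => // k.
  have := prob_gt0 k `[alpha k / lambda k, +oo[%classic (measurable_itv _).
  rewrite lebesgue_measure_itv /= ltry => /(_ erefl).
  congr (0 < fine (P _)); apply/seteqP.
  by split=> w /=; rewrite in_itv/= andbT ler_pM2r// invr_gt0.
have := prob_gt0 k `]-oo, alpha k / lambda k]%classic (measurable_itv _).
rewrite lebesgue_measure_itv /= ltNyr => /(_ erefl).
congr (0 < fine (P _)); apply/seteqP.
by split=> w /=; rewrite in_itv/= ler_pM2r// invr_gt0.
Qed.

(** The standardised variables all have the same law, so a truncation level found for index 0 serves
    every [k]. *)
Lemma regular_density_mean_trunc : exists2 M : R, 0 <= M &
  forall k, 2^-1 <= \int[P]_w (Y k w / sigma k * trunc M (Y k w / sigma k)).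
Proof.
case: densY => lambda [phi [lambda0 [_ [_ [dens _]]]]].
pose zeta k w := Y k w / lambda k.
have mz k : measurable_fun setT (zeta k) by exact: measurable_funM.
have law k A : measurable A -> P (zeta 0%N @^-1` A) = P (zeta k @^-1` A).
  by move=> mA; rewrite !dens.
have z2 k : has_mean P (fun w => zeta k w ^+ 2) ((sigma k / lambda k) ^+ 2).
  apply: eq_has_mean (has_meanZ (lambda k ^- 2) (Y2 k)) _ _ => [w|].
    by rewrite /zeta exprMn exprVn mulrC.
  by rewrite exprMn exprVn mulrC.
pose s := sigma 0%N / lambda 0%N.
have s0 : 0 < s by rewrite divr_gt0.
(* Equal laws have equal second moments, so [sigma] and [lambda] are proportional. *)
have sE k : sigma k / lambda k = s.
  have sq : measurable_fun setT (fun x : R => x ^+ 2).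
    by apply: measurable_funX; exact: measurable_id.
  have := has_mean_same_law (mz 0%N) (mz k) sq (law k) (z2 0%N).
  move/has_meanE; rewrite [LHS](has_meanE (z2 k)).
  by move/eqP; rewrite eqrXn2 ?divr_ge0 ?ltW// => /eqP.
have zY k w : Y k w / sigma k = zeta k w / s.
  by rewrite /zeta -(sE k); field; rewrite !gt_eqF.
have [||M M0 HM] := @exists_mean_trunc _ _ _ P (fun w => Y 0%N w / sigma 0%N).
- apply: eq_has_mean (has_meanZ (sigma 0%N ^- 2) (Y2 0%N)) _ _ => [w|].
    by rewrite exprMn exprVn mulrC.
  by rewrite mulVf// sqrf_eq0 gt_eqF.
- exact: measurable_funM.
exists M => // k.
pose f (x : R) := x / s * trunc M (x / s).
have mdiv : measurable_fun setT (fun x : R => x / s).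
  by apply: measurable_funM => //; exact: measurable_id.
have mf : measurable_fun setT f.
  by apply: measurable_funM => //; apply: measurableT_comp => //; exact: measurable_trunc.
have f0 : has_mean P (f \o zeta 0%N) (\int[P]_w (f (zeta 0%N w))).
  apply: (@has_mean_dominated _ _ _ _ _ (fun w => s ^- 2 * zeta 0%N w ^+ 2)).
  - exact: measurableT_comp.
  - move=> w; rewrite ger0_norm ?trunc_mul_ge0// (le_trans (trunc_mul_le _ _))//.
    by rewrite exprMn exprVn mulrC.
  - exact: (has_meanZ (s ^- 2) (z2 0%N)).
have := has_meanE (has_mean_same_law (mz 0%N) (mz k) mf (law k) f0).
under eq_Rintegral => w _ do rewrite /f /= -zY.
move=> ->; apply: le_trans HM _; rewrite le_eqVlt; apply/orP; left; apply/eqP.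
by apply: eq_Rintegral => w _; rewrite /f -zY.
Qed.

End regular_density.

(** After division by [sigma k], the fourth moments are all at most [c], so one truncation level
    depending on [c] alone suffices. *)
Lemma mean_trunc_of_exp4 {R : realType} d (Omega : measurableType d)
    (P : probability Omega R) (Y : nat -> Omega -> R) (sigma : nat -> R) :
  (forall k, measurable_fun setT (Y k)) -> (forall k, 0 < sigma k) ->
  (forall k, has_mean P (fun w => Y k w ^+ 2) (sigma k ^+ 2)) ->
  (exists c : R, forall k,
     ('E_P[fun w => (Y k w ^+ 4)%R] <= c%:E * 'E_P[fun w => (Y k w ^+ 2)%R] ^+ 2)%E) ->
  exists2 M : R, 0 <= M &
    forall k, 2^-1 <= \int[P]_w (Y k w / sigma k * trunc M (Y k w / sigma k)).
Proof.
move=> mY sigma0 Y2 [c Hc].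
exists (1 + 2 * `|c|) => [|k]; first by rewrite addr_ge0// mulr_ge0.
have mYk : measurable_fun setT (fun w => Y k w / sigma k) by exact: measurable_funM.
have E2 : ('E_P[fun w => (Y k w ^+ 2)%R] = (sigma k ^+ 2)%:E)%E.
  rewrite unlock; have [Y2i <-] := Y2 k.
  by rewrite /Rintegral fineK//; exact: integrable_fin_num.
have := Hc k; rewrite E2 -EFin_expe -EFinM unlock => le4.
set m4 := (\int[P]_w (Y k w ^+ 4)%:E)%E in le4.
have Y40 w : 0 <= Y k w ^+ 4 by rewrite -[4%N]/(2 * 2)%N exprM sqr_ge0.
have m40 : (0 <= m4)%E by apply: integral_ge0 => w _; rewrite lee_fin.
have m4fin : m4 \is a fin_num by rewrite ge0_fin_numE// (le_lt_trans le4)// ltry.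
have Y4 : has_mean P (fun w => Y k w ^+ 4) (fine m4).
  by apply: ge0_has_mean => //; [exact: measurable_funX|rewrite fineK].
apply: (@mean_trunc_exp4 _ _ _ _ _ c (sigma k ^- 4 * fine m4)) => //.
- apply: eq_has_mean (has_meanZ (sigma k ^- 2) (Y2 k)) _ _ => [w|].
    by rewrite exprMn exprVn mulrC.
  by rewrite mulVf// sqrf_eq0 gt_eqF.
- apply: eq_has_mean (has_meanZ (sigma k ^- 4) Y4) _ _ => // w.
  by rewrite exprMn exprVn mulrC.
- rewrite mulrC ler_pdivrMr ?exprn_gt0//.
  by rewrite -(fineK m4fin) lee_fin in le4; rewrite -[4%N]/(2 * 2)%N exprM.
Qed.

(** The lower limit is a supremum of tail infima, so one tail infimum is already positive; it serves
    as [delta]. *)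
Lemma limn_einf_gt0 {R : realType} (u : nat -> \bar R) :
  (forall k, u k \is a fin_num) -> (0 < limn_einf u)%E ->
  exists (delta : R) (N : nat), 0 < delta /\
    forall k, (N <= k)%N -> delta <= fine (u k).
Proof.
move=> ufin; rewrite limn_einf_lim (cvg_lim _ (cvg_einfs_sup (u := u)))//.
move=> /ereal_sup_gt[_ [N _ <-]] u0.
have le_u k : (N <= k)%N -> (einfs u N <= u k)%E.
  by move=> Nk; apply: ereal_inf_lbound; exists k.
have efin : einfs u N \is a fin_num.
  rewrite ge0_fin_numE ?ltW//; apply: le_lt_trans (le_u N (leqnn _)) _.
  by rewrite ltey_eq ufin.
exists (fine (einfs u N)), N; split; first by rewrite fine_gt0// u0 ltey_eq efin.
by move=> k Nk; rewrite fine_le// le_u.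
Qed.

Lemma HD_empirical_eq0 {R : realType} (d : measure_display) (F : measurableType d)
    (s : nat -> F -> R) (b : F) (x : nat -> F) n k :
  (forall j, (j < n)%N -> s k (x j) < s k b) ->
  HD (finite_combinations s) b (empirical x n) = 0%E.
Proof.
move=> lt_s; apply/eqP; rewrite eq_le; apply/andP; split; last first.
  by apply: le_ereal_inf_tmp => _ [f _ <-]; exact: mule_ge0.
apply: ereal_inf_lbound; exists (s k).
  (* [k.+1] terms are taken so that [k] is the last index. *)
  exists k.+1, (fun i => (i == k)%:R); apply/funext => y.
  rewrite big_ord_recr /= eqxx mul1r big1 ?add0r// => i _.
  by rewrite ltn_eqF ?mul0r.
change (((n%:R^-1 : R)%:E * \sum_(j < n)
  (\d_(x j) [set y | (s k b <= s k y)%R] : \bar R) = 0)%E).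
rewrite big1 ?mule0// => j _.
rewrite diracE memNset// => /= ; apply/negP; rewrite -ltNge; exact: lt_s.
Qed.

(** * Failure and validity of consistency at a point *)

Theorem corollary1 (R : realType)
  (dO : measure_display) (Omega : measurableType dO) (P : probability Omega R)
  (B : topologicalLmodType R) (hB : separable_Fspace B)
  (X : {RV P >-> borelType B})
  (Xs : nat -> {RV P >-> borelType B}) (hXs : iid_copies X Xs)
  (t : nat -> borelType B -> R)
  (ht : forall k, measurable_fun setT (t k))
  (sigma : nat -> R) (hsigma : forall k, 0 < sigma k)
  (hindep : mutually_independent P (fun k w => t k (X w)))
  (hint : forall k, P.-integrable setT (fun w => (t k (X w))%:E))
  (hmean : forall k, ('E_P[fun w => t k (X w)] = 0)%E)
  (hvar : forall k, ('V_P[fun w => t k (X w)] = (sigma k ^+ 2)%:E)%E)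
  (hliminf : forall c : nat -> R,
     (c k / sigma k @[k --> \oo] --> (0 : R)) ->
     (0 < limn_einf (fun k => P [set w | (t k (X w) < c k)%R]))%E)
  (a : B)
  (hA :
     ((forall d : nat, (1 <= d)%N ->
         (0 < HD (@linear_functionals R d) (Pi t d a)
                 (pushforward (distribution P X) (Pi t d)))%E)
      /\
      (exists c : R, forall k,
         ('E_P[fun w => (t k (X w) ^+ 4)%R]
            <= c%:E * 'E_P[fun w => (t k (X w) ^+ 2)%R] ^+ 2)%E))
     \/ iid_scaled_regular_density P (fun k w => t k (X w))) :
  ((\sum_(0 <= k <oo) ((t k a) ^+ 2 / sigma k ^+ 2)%:E < +oo)%E ->
     [/\ {ae P, forall w, forall n : nat, (1 <= n)%N ->
            HD (finite_combinations t) a (empirical (fun j => Xs j w) n) = 0%E},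
         (0 < HD (finite_combinations t) a (distribution P X))%E &
         {ae P, forall w,
            ~ (HD (finite_combinations t) a (empirical (fun j => Xs j w) n)
                 @[n --> \oo]
               --> HD (finite_combinations t) a (distribution P X))}])
  /\
  ((\sum_(0 <= k <oo) ((t k a) ^+ 2 / sigma k ^+ 2)%:E = +oo)%E ->
     (t k a / sigma k @[k --> \oo] --> (0 : R)) ->
     {ae P, forall w,
        HD (finite_combinations t) a (empirical (fun j => Xs j w) n)
          @[n --> \oo]
        --> HD (finite_combinations t) a (distribution P X)}).
Proof.
pose Y k w := t k (X w); pose alpha k := t k a.
have mY k : measurable_fun setT (Y k) by exact: measurableT_comp.
have Y1 k : has_mean P (Y k) 0 := expectation_has_mean (hint k) (hmean k).
have Y2 k : has_mean P (fun w => Y k w ^+ 2) (sigma k ^+ 2).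
  exact: variance_has_mean (mY k) (hmean k) (hvar k).
have mlt k : measurable [set w | Y k w < alpha k].
  rewrite (_ : [set w | _] = Y k @^-1` `]-oo, alpha k[%classic).
    by rewrite -[X in measurable X]setTI; exact: mY.
  by apply/seteqP; split=> w /=; rewrite in_itv.
(* Shared by both claims: the lower limit hypothesis at [c k = t k a] bounds the probabilities of
   [t k (X w) < t k a] from below for large [k]. *)
have empirical0 : alpha k / sigma k @[k --> \oo] --> (0 : R) ->
    {ae P, forall w, forall n, (1 <= n)%N ->
       HD (finite_combinations t) a (empirical (fun j => Xs j w) n) = 0%E}.
  move=> /hliminf/limn_einf_gt0 [|delta [N [delta0 HN]]].
    by move=> k; exact: (fin_num_measure P _ (mlt k)).
  pose A k := [set x | t k x < t k a].
  have mA k : measurable (A k).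
    rewrite (_ : A k = t k @^-1` `]-oo, t k a[%classic).
      by rewrite -[X in measurable X]setTI; exact: ht.
    by apply/seteqP; split=> x /=; rewrite in_itv.
  have indA s : uniq s -> fine (P (X @^-1` \bigcap_(k in [set` s]) A k)) =
      \prod_(k <- s) fine (P (X @^-1` A k)).
    move=> us.
    have AE k : X @^-1` A k = Y k @^-1` `]-oo, alpha k[%classic.
      by apply/seteqP; split=> w /=; rewrite in_itv.
    have := @mutually_independent_seq _ _ _ P _ _ Y s
      (fun k => `]-oo, alpha k[%classic) hindep us (fun _ _ => measurable_itv _).
    rewrite (eq_bigr (fun k => (fine (P (X @^-1` A k)))%:E)); last first.
      by move=> k _; rewrite -AE fineK//; exact: (fin_num_measure P _ (mlt k)).
    rewrite prodEFin => PE; rewrite -[RHS]/(fine (\prod_(k <- s) fine (P (X @^-1` A k)))%:E) -PE.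
    by congr (fine (P _)).
  have occ := iid_events_occur hXs mA indA delta0 HN.
  apply: (filterS _ occ) => w Hw n _.
  have [k Hk] := Hw n; exact: HD_empirical_eq0 Hk.
have cvg0 : alpha k / sigma k @[k --> \oo] --> (0 : R) ->
    {ae P, forall w, HD (finite_combinations t) a (empirical (fun j => Xs j w) n)
       @[n --> \oo] --> 0%E}.
  move=> /empirical0 H; apply: (filterS _ H) => w Hw.
  by apply: cvg_near_cst; exists 1%N => // n /= n1; exact: Hw.
have HDE f : finite_combinations t f -> exists n (c : nat -> R),
    distribution P X [set x | f a <= f x] =
    P [set w | \sum_(k < n) c k * alpha k <= \sum_(k < n) c k * Y k w].
  by move=> [n [c ->]]; exists n, c.
have mhalf n (c : nat -> R) : measurable
    [set w | \sum_(k < n) c k * alpha k <= \sum_(k < n) c k * Y k w].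
  exact: (measurable_half_space mY n c _ xpredT).
split=> [sum_lt|sum_oo alpha0].
  pose f k := alpha k ^+ 2 / sigma k ^+ 2.
  have f0 k : 0 <= f k by rewrite divr_ge0 ?sqr_ge0.
  have tail e (e0 : 0 < e) : exists N : nat, forall n,
      \sum_(k < n | ~~ (k < N)%N) f k <= e by exact: series_tail_le.
  have alpha0 : alpha k / sigma k @[k --> \oo] --> (0 : R).
    apply/cvgrPdist_le => e e0.
    have [N HN] := tail (e ^+ 2) (exprn_gt0 _ e0).
    (* A single term of index [k] past [N] is bounded by the tail sum up to and including [k]. *)
    exists N => // k /= Nk; rewrite sub0r normrN.
    have : f k <= e ^+ 2.
      apply: le_trans (HN k.+1); rewrite big_mkcond big_ord_recr /=.
      by rewrite -leqNgt Nk lerDr sumr_ge0// => i _; case: ifP.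
    rewrite /f -expr_div_n -(real_normK (num_real (_ / _))).
    by rewrite ler_sqr ?nnegrE// ltW.
  have [eta eta0 Heta] : exists2 eta : R, 0 < eta & forall n (c : nat -> R), eta <=
      fine (P [set w | \sum_(k < n) c k * alpha k <= \sum_(k < n) c k * Y k w]).
    (* The head has length [n.+1] because positive depth is assumed in dimensions at least 1
       only. *)
    have headE n : exists2 h : R, 0 < h & forall c : nat -> R, h <= fine (P
        [set w | \sum_(k < n.+1) c k * alpha k <= \sum_(k < n.+1) c k * Y k w]).
      case: hA => [[hHD _]|hdens]; first exact: linear_depth_bound (hHD n.+1 isT).
      exact: (regular_density_half_space_bound mY hindep hdens).
    have [M M0 HM] : exists2 M : R, 0 <= M &
        forall k, 2^-1 <= \int[P]_w (Y k w / sigma k * trunc M (Y k w / sigma k)).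
      case: hA => [[_ h4]|hdens]; first exact: mean_trunc_of_exp4.
      exact: regular_density_mean_trunc.
    pose xi k w := Y k w / sigma k.
    have mxi k : measurable_fun setT (xi k) by exact: measurable_funM.
    have indxi : mutually_independent P xi.
      apply: (@mutually_independent_comp _ _ _ P _ _ _ _ Y (fun k y => y / sigma k)) => // k.
      by apply: measurable_funM => //; exact: measurable_id.
    have xi1 k : has_mean P (xi k) 0.
      apply: eq_has_mean (has_meanZ (sigma k)^-1 (Y1 k)) _ _ => [w|].
        by rewrite mulrC.
      by rewrite mulr0.
    have xi2 k : has_mean P (fun w => xi k w ^+ 2) 1.
      apply: eq_has_mean (has_meanZ (sigma k ^- 2) (Y2 k)) _ _ => [w|].
        by rewrite exprMn exprVn mulrC.
      by rewrite mulVf// sqrf_eq0 gt_eqF.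
    have [e [delta [e0 delta0 Hanti]]] := sum_anticoncentration mxi indxi xi1 xi2 M0 HM.
    have [N HN] := tail (e ^+ 2) (exprn_gt0 _ e0).
    (* Lengthening the head from [N] to [N.+1] only shrinks the tail sums. *)
    apply: (@half_space_lower_bound _ _ _ _ _ mY hindep _ _ hsigma e delta N.+1) => // n.
    apply: le_trans (HN n); rewrite big_mkcond [leRHS]big_mkcond; apply: ler_sum => k _.
    case: (ltnP k N.+1) => /=; first by move=> _; case: ifP.
    by move=> Nk; rewrite -leqNgt (ltnW Nk).
  have HD0 : (0 < HD (finite_combinations t) a (distribution P X))%E.
    apply: (@lt_le_trans _ _ eta%:E); first by rewrite lte_fin.
    apply: le_ereal_inf_tmp => _ [g /HDE[n [c gE]] <-]; rewrite gE.
    by rewrite -[leRHS]fineK ?fin_num_measure// lee_fin.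
  split => //; first exact: empirical0.
  (* The empirical depths tend to 0, so convergence to the positive depth would contradict
     uniqueness of limits. *)
  apply: (filterS _ (cvg0 alpha0)) => w cv0 cv.
  by have /eqP := lt_eqF HD0; apply; exact: (cvg_unique _ cv0 cv).
have -> : HD (finite_combinations t) a (distribution P X) = 0%E; last exact: cvg0.
apply/eqP; rewrite eq_le; apply/andP; split; last first.
  by apply: le_ereal_inf_tmp => _ [g _ <-].
apply/lee_addgt0Pr => e e0; rewrite add0e.
pose s n := \sum_(k < n) alpha k ^+ 2 / sigma k ^+ 2.
(* Partial sums bounded by [e^-1] would make the series finite; past that value, Chebyshev gives
   mass at most [e]. *)
have [n sn] : exists n, e^-1 < s n.
  apply: contrapT => /forallNP sle.
  suff /lt_eqF/eqP : (\sum_(0 <= k <oo) (t k a ^+ 2 / sigma k ^+ 2)%:E < +oo)%E by [].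
  apply: le_lt_trans (ltry e^-1).
  apply: lime_le; first by apply: is_cvg_nneseries => k _ _; rewrite lee_fin divr_ge0 ?sqr_ge0.
  apply: nearW => n; rewrite sumEFin lee_fin big_mkord leNgt; apply/negP; exact: sle.
have s0 : 0 < s n by apply: lt_trans sn; rewrite invr_gt0.
apply: (@le_trans _ _ (P [set w | \sum_(k < n) alpha k / sigma k ^+ 2 * alpha k <=
                   \sum_(k < n) alpha k / sigma k ^+ 2 * Y k w])).
  apply: ereal_inf_lbound.
  exists (fun x => \sum_(k < n) alpha k / sigma k ^+ 2 * t k x) => //.
  by exists n, (fun k => alpha k / sigma k ^+ 2).
rewrite -(fineK (fin_num_measure P _ (mhalf n (fun k => alpha k / sigma k ^+ 2)))).
rewrite lee_fin.
have := half_space_chebyshev mY hindep alpha hsigma n Y1 Y2.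
rewrite -/(s n) -ler_pdivlMr// mul1r => /le_trans; apply.
by rewrite -[leRHS]invrK lef_pV2 ?posrE ?invr_gt0// ltW.
Qed.
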